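(* Assume that the DO solution $R(t)\in\mathscr{M}$, i.e. the solution of $$\dot R=\Pi_{\mathcal{T}(R)}(\mathcal{L}(t,R)),\qquad R(0)=\Pi_{\mathscr{M}}(\mathfrak{R}(0)),$$ is defined on a time interval $[0,T]$ discretized with $N_T$ time steps $\Delta t=T/N_T$, and denote $t^n=n\Delta t$. Consider the sequence $R^n$ obtained from the class of schemes $$R^{n+1}=\Pi_{\mathscr{M}}\left(R^n+\Delta t\,\overline{\mathcal{L}}(t^n,R^n,\Delta t)\right),\qquad R^0=\Pi_{\mathscr{M}}(\mathfrak{R}(0)).$$ Assume that $\mathcal{L}$ is Lipschitz continuous, that is, there exists a constant $K$ such that $$\forall t\in[0,T],\ \forall A,B\in\mathcal{M}_{l,m},\quad\|\mathcal{L}(t,A)-\mathcal{L}(t,B)\|\le K\|A-B\|.$$ Then the sequence $R^n$ converges uniformly to the DO solution $R(t)$ in the following sense: $$\sup_{0\le n\le N_T}\|R^n-R(t^n)\|\underset{\Delta t\to0}{\longrightarrow}0.$$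
   Context: $\mathcal{M}_{l,m}$ is the space of $l\times m$ real matrices with the Frobenius inner product and norm $\|\cdot\|$. $\mathscr{M}=\{R\in\mathcal{M}_{l,m} : \mathrm{rank}(R)=r\}$ is the fixed rank manifold, $\mathcal{T}(R)$ its tangent space at $R$, and $\Pi_{\mathcal{T}(R)}$ the orthogonal projection onto $\mathcal{T}(R)$. $\Pi_{\mathscr{M}}(A)$ is the rank $r$ truncated SVD of $A$, i.e. the unique closest point to $A$ in $\mathscr{M}$, defined when the $r$-th and $(r+1)$-th singular values satisfy $\sigma_r(A)>\sigma_{r+1}(A)$. $\mathcal{L}(t,\cdot)$ is a time-dependent operator acting on $\mathcal{M}_{l,m}$, and $\mathfrak{R}(t)$ is the solution of the full system $\dot{\mathfrak{R}}=\mathcal{L}(t,\mathfrak{R})$ with initial value $\mathfrak{R}(0)$. A time integration of this full system over $(t^n,t^{n+1})$ is written $\mathfrak{R}^{n+1}=\mathfrak{R}^n+\Delta t\,\overline{\mathcal{L}}(t^n,\mathfrak{R}^n,\Delta t)$, where $\overline{\mathcal{L}}(t,\mathfrak{R},\Delta t)$ denotes the full-space integral $\frac{1}{\Delta t}\int_t^{t+\Delta t}\mathcal{L}(s,\mathfrak{R}(s))\,ds$ for the exact integration, or the increment function for a numerical integration, for example $\overline{\mathcal{L}}(t,\mathfrak{R},\Delta t)=\mathcal{L}(t,\mathfrak{R})$ for forward Euler and $\overline{\mathcal{L}}(t,\mathfrak{R},\Delta t)=\mathcal{L}(t+\Delta t/2,\mathfrak{R}+\frac{\Delta t}{2}\mathcal{L}(t,\mathfrak{R}))$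 for a second-order Runge-Kutta scheme. The time marching is consistent with the exact integration: $\overline{\mathcal{L}}(t,R,0)=\mathcal{L}(t,R)$.
   Formalization: Consistency is taken to include that the increment function L̄(t,R,Δt) is jointly continuous at Δt=0 (for steps staying in [0,T]), so L is continuous in (t,R); with only L̄(t,R,0)=L(t,R) the claim fails, e.g. L=0 and L̄=1 for all Δt>0. *)

(* Defs.v *)
From HB Require Import structures.
From mathcomp Require Import all_boot all_order all_algebra.
From mathcomp Require Import all_classical all_reals all_analysis.

Set Implicit Arguments.
Unset Strict Implicit.
Unset Printing Implicit Defensive.
Import Order.TTheory GRing.Theory Num.Theory.
Import numFieldNormedType.Exports.
Local Open Scope classical_set_scope.
Local Open Scope ring_scope.

(* The library norm on 'M[R]_(l, m) is the sup norm; it is only used below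
   through its topology, which is also that of the Frobenius norm. *)
Definition frob_dot {R : realType} {l m : nat} (A B : 'M[R]_(l, m)) : R :=
  \tr (A^T *m B).

Definition frob {R : realType} {l m : nat} (A : 'M[R]_(l, m)) : R :=
  Num.sqrt (frob_dot A A).

Definition fixed_rank {R : realType} {l m : nat} (r : nat) :
  set 'M[R]_(l, m) := [set A | \rank A = r].

(* Velocities at time 0 of the differentiable curves drawn on the manifold
   that pass through A at time 0. *)
Definition tangent {R : realType} {l m : nat} (r : nat) (A : 'M[R]_(l, m)) :
  set 'M[R]_(l, m) :=
  [set X | exists g : R -> 'M[R]_(l, m),
    [/\ g 0 = A,
        \forall t \near (0 : R), fixed_rank r (g t),
        \forall t \near (0 : R), derivable g t 1
      & is_derive (0 : R) 1 g X]].

(* The value is 0 if E has no point P such that B - P is orthogonal to E. *)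
Definition orth_proj {R : realType} {l m : nat} (E : set 'M[R]_(l, m))
    (B : 'M[R]_(l, m)) : 'M[R]_(l, m) :=
  xget 0 [set P | E P /\ forall Y, E Y -> frob_dot (B - P) Y = 0].

Definition rect_diag {R : realType} (l m : nat) (s : nat -> R) :
  'M[R]_(l, m) := \matrix_(i, j) (s i *+ (i == j :> nat)).

(* Indices start at 0: the k-th singular value of A is s k.-1, and
   s vanishes from minn l m on. *)
Definition is_svd {R : realType} {l m : nat} (A : 'M[R]_(l, m))
    (U : 'M[R]_l) (s : nat -> R) (V : 'M[R]_m) : Prop :=
  [/\ U^T *m U = 1%:M,
      V^T *m V = 1%:M,
      (forall i j, (i <= j)%N -> s j <= s i),
      (forall k, (minn l m <= k)%N -> s k = 0)
    & A = U *m rect_diag l m s *m V^T].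

(* sigma_r(A) > sigma_{r+1}(A); never satisfied for r = 0. *)
Definition svd_gap {R : realType} {l m : nat} (r : nat)
    (A : 'M[R]_(l, m)) : Prop :=
  exists U s V, is_svd A U s V /\ s r < s r.-1.

(* The value is 0, which is not of rank r, if svd_gap r A fails. *)
Definition trunc_svd {R : realType} {l m : nat} (r : nat)
    (A : 'M[R]_(l, m)) : 'M[R]_(l, m) :=
  xget 0 [set B | exists U s V,
    [/\ is_svd A U s V, s r < s r.-1
      & B = U *m rect_diag l m (fun k => if (k < r)%N then s k else 0)
              *m V^T]].

(* The one-sided derivatives at 0 and T are not required: when F (t, X t) is
   continuous in t they follow from the two clauses. *)
Definition solves_on {R : realType} {l m : nat} (T : R)
    (F : R -> 'M[R]_(l, m) -> 'M[R]_(l, m)) (X : R -> 'M[R]_(l, m)) : Prop :=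
  {within `[0, T], continuous X} /\
  forall t : R, 0 < t < T -> is_derive t 1 X (F t (X t)).

Definition lipschitz_frob {R : realType} {l m : nat} (T K : R)
    (L : R -> 'M[R]_(l, m) -> 'M[R]_(l, m)) : Prop :=
  forall t, 0 <= t <= T ->
  forall A B, frob (L t A - L t B) <= K * frob (A - B).

(* In the theory of one-step methods the equation Lbar t A 0 = L t A expresses
   consistency for increment functions that are continuous in (t, A, h).  Here
   continuity is only required at h = 0, for steps that stay in [0, T]; without
   it the values of Lbar at h > 0 would be unrelated to L. *)
Definition consistent {R : realType} {l m : nat} (T : R)
    (L : R -> 'M[R]_(l, m) -> 'M[R]_(l, m))
    (Lbar : R -> 'M[R]_(l, m) -> R -> 'M[R]_(l, m)) : Prop :=
  forall t, 0 <= t <= T -> forall A : 'M[R]_(l, m),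
    Lbar t A 0 = L t A /\
    Lbar p.1.1 p.1.2 p.2 @[p --> within
        [set p : R * 'M[R]_(l, m) * R |
           [/\ 0 <= p.1.1, 0 <= p.2 & p.1.1 + p.2 <= T]]
        (nbhs (t, A, 0 : R))] --> Lbar t A 0.

Fixpoint scheme {R : realType} {l m : nat} (r : nat)
    (Lbar : R -> 'M[R]_(l, m) -> R -> 'M[R]_(l, m))
    (A0 : 'M[R]_(l, m)) (h : R) (n : nat) : 'M[R]_(l, m) :=
  if n is n'.+1 then
    let Rn := scheme r Lbar A0 h n' in
    trunc_svd r (Rn + h *: Lbar (n'%:R * h) Rn h)
  else trunc_svd r A0.

(* Main.v *)
Require Import Defs.
From HB Require Import structures.
From mathcomp Require Import all_boot all_order all_algebra.
From mathcomp Require Import all_classical all_reals all_analysis.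
From mathcomp Require Import zify ring lra.

Set Implicit Arguments.
Unset Strict Implicit.
Unset Printing Implicit Defensive.
Import Order.TTheory GRing.Theory Num.Theory.
Import numFieldNormedType.Exports.
Local Open Scope classical_set_scope.
Local Open Scope ring_scope.

(** If [N] is normal to the fixed rank manifold at [A] ([A^T N = 0] and
    [N A^T = 0]), then for [B] of the same rank close to [A] one has
    [|<N, B - A>| <= C |N| |B - A|^2].  Both the defect [L - Pi_T(L)] of the
    projected velocity and the defect [Y - trunc_svd Y] of the truncation are
    normal, so each of them only enters the error through this quadratic term.
    Over one step the squared error [e^2] therefore satisfies
    [e_+^2 + eta <= (1 + Lam h) (e^2 + eta)], where [eta] bounds the consistency
    errors and goes to 0 with [h]; a discrete Gronwall argument concludes.  The
    constants are uniform along the compact path of the DO solution, and the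
    induction keeps the scheme in the tube around it where they are valid. *)

(** * Frobenius norm *)

Section Frobenius.
Context {R : realType}.

(** Two obstacles shape the argument. Consistency carries no rate and no Lipschitz bound for [Lbar].
    A step is therefore compared with the path X itself, through the derivative of the squared
    distance along the segment from A to A + h Lbar, so that no second derivative of X enters.
    Moreover truncation is not nonexpansive, and a fixed Lipschitz constant above 1 would be raised
    to the power N. What saves the estimate is that the current iterate A has rank r: truncation
    moves Y = A + h Lbar by O(h) only, and the quadratic bound then yields a factor 1 / (1 - O(h)).
    The C of that bound comes from a generalized inverse of B, which can be chosen bounded while B
    has rank r and stays near a compact path of rank r matrices. *)

Lemma frob_dotE l m (A B : 'M[R]_(l, m)) :
  frob_dot A B = \sum_i \sum_j A i j * B i j.
Proof.
rewrite /frob_dot /mxtrace exchange_big /=; apply: eq_bigr => j _.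
by rewrite mxE; apply: eq_bigr => i _; rewrite mxE.
Qed.

Section Bilinear.
Context {l m : nat}.
Implicit Types A B C : 'M[R]_(l, m).

Lemma frob_dotC A B : frob_dot A B = frob_dot B A.
Proof. by rewrite /frob_dot -mxtrace_tr trmx_mul trmxK. Qed.

Lemma frob_dotDl A B C : frob_dot (A + B) C = frob_dot A C + frob_dot B C.
Proof. by rewrite /frob_dot linearD mulmxDl mxtraceD. Qed.

Lemma frob_dotZl a A C : frob_dot (a *: A) C = a * frob_dot A C.
Proof. by rewrite /frob_dot linearZ -scalemxAl mxtraceZ. Qed.

Lemma frob_dotNl A C : frob_dot (- A) C = - frob_dot A C.
Proof. by rewrite -scaleN1r frob_dotZl mulN1r. Qed.

Lemma frob_dotBl A B C : frob_dot (A - B) C = frob_dot A C - frob_dot B C.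
Proof. by rewrite frob_dotDl frob_dotNl. Qed.

Lemma frob_dotDr C A B : frob_dot C (A + B) = frob_dot C A + frob_dot C B.
Proof. by rewrite frob_dotC frob_dotDl !(frob_dotC C). Qed.

Lemma frob_dotZr a C A : frob_dot C (a *: A) = a * frob_dot C A.
Proof. by rewrite frob_dotC frob_dotZl (frob_dotC C). Qed.

Lemma frob_dotNr C A : frob_dot C (- A) = - frob_dot C A.
Proof. by rewrite frob_dotC frob_dotNl (frob_dotC C). Qed.

Lemma frob_dotBr C A B : frob_dot C (A - B) = frob_dot C A - frob_dot C B.
Proof. by rewrite frob_dotDr frob_dotNr. Qed.

Lemma frob_dot0r A : frob_dot A 0 = 0.
Proof. by rewrite -(scale0r 0) frob_dotZr mul0r. Qed.

Lemma frob_dotxx_ge0 A : 0 <= frob_dot A A.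
Proof.
by rewrite frob_dotE; apply: sumr_ge0 => i _; apply: sumr_ge0 => j _;
  rewrite -expr2 sqr_ge0.
Qed.

Lemma frob_ge0 A : 0 <= frob A. Proof. exact: sqrtr_ge0. Qed.

Lemma sqr_frob A : frob A ^+ 2 = frob_dot A A.
Proof. by rewrite sqr_sqrtr // frob_dotxx_ge0. Qed.

Lemma frob0 : frob (0 : 'M[R]_(l, m)) = 0.
Proof. by rewrite /frob frob_dot0r sqrtr0. Qed.

Lemma frobN A : frob (- A) = frob A.
Proof. by rewrite /frob frob_dotNl frob_dotNr opprK. Qed.

Lemma frobBC A B : frob (A - B) = frob (B - A).
Proof. by rewrite -frobN opprB. Qed.

Lemma frobZ a A : frob (a *: A) = `|a| * frob A.
Proof.
by rewrite /frob frob_dotZl frob_dotZr mulrA -expr2 sqrtrM ?sqr_ge0 ?sqrtr_sqr.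
Qed.

Lemma le_frob_sqr A c : 0 <= c -> frob_dot A A <= c ^+ 2 -> frob A <= c.
Proof.
by move=> c0; rewrite -sqr_frob ler_pXn2r // nnegrE frob_ge0.
Qed.

Lemma entry_le_frob A i j : `|A i j| <= frob A.
Proof.
rewrite -(@ler_pXn2r _ 2) ?nnegrE ?frob_ge0 // sqr_frob frob_dotE.
rewrite real_normK ?num_real // (bigD1 i) //= (bigD1 j) //= -expr2 -addrA.
rewrite lerDl addr_ge0 ?sumr_ge0 // => [k _|k _].
  by rewrite -expr2 sqr_ge0.
by apply: sumr_ge0 => n _; rewrite -expr2 sqr_ge0.
Qed.

Lemma frob_eq0 A : frob A = 0 -> A = 0.
Proof.
move=> A0; apply/matrixP => i j; rewrite mxE; apply/normr0_eq0/eqP.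
by rewrite eq_le normr_ge0 -A0 entry_le_frob.
Qed.

(** The sharp factor is the square root of l m; the cruder one only affects constants. *)
Lemma frob_le_entries A e : 0 <= e -> (forall i j, `|A i j| <= e) ->
  frob A <= (l * m)%:R * e.
Proof.
move=> e0 Ae; apply: le_frob_sqr; first by rewrite mulr_ge0.
rewrite frob_dotE; apply: (@le_trans _ _ (\sum_(i < l) \sum_(j < m) e ^+ 2)).
  apply: ler_sum => i _; apply: ler_sum => j _.
  by rewrite -expr2 -real_normK ?num_real // ler_pXn2r ?nnegrE.
rewrite sumr_const sumr_const !card_ord -mulrnA mulnC exprMn -[_ *+ _]mulr_natl.
rewrite ler_wpM2r ?sqr_ge0 // -natrX ler_nat.
by case: (l * m)%N => // k; rewrite leq_pmulr.
Qed.

Lemma frob_CS A B : `|frob_dot A B| <= frob A * frob B.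
Proof.
have [/frob_eq0->|B0] := eqVneq (frob B) 0.
  by rewrite frob_dot0r frob0 normr0 mulr0.
have Bgt : 0 < frob B by rewrite lt_def B0 frob_ge0.
(* This is the part of A orthogonal to B, scaled by |B|^2 to avoid a division. *)
have := frob_dotxx_ge0 (frob B ^+ 2 *: A - frob_dot A B *: B).
rewrite !(frob_dotBl, frob_dotBr, frob_dotZl, frob_dotZr) (frob_dotC B A).
rewrite -!sqr_frob => H.
rewrite -(@ler_pXn2r _ 2) ?nnegrE ?mulr_ge0 ?frob_ge0 //.
rewrite real_normK ?num_real // exprMn -subr_ge0.
have B2 : 0 < frob B ^+ 2 by rewrite exprn_gt0.
rewrite -(pmulr_rge0 _ B2); apply: le_trans H _; rewrite le_eqVlt; apply/orP.
by left; apply/eqP; ring.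
Qed.

Lemma frob_dot_le A B : frob_dot A B <= frob A * frob B.
Proof. exact: le_trans (ler_norm _) (frob_CS A B). Qed.

Lemma frobD A B : frob (A + B) <= frob A + frob B.
Proof.
apply: le_frob_sqr; first by rewrite addr_ge0 ?frob_ge0.
rewrite !(frob_dotDl, frob_dotDr) (frob_dotC B A) -!sqr_frob.
have := frob_dot_le A B; nra.
Qed.

Lemma frobB_le A B : frob (A - B) <= frob A + frob B.
Proof. by rewrite -(frobN B) frobD. Qed.

Lemma frob_dist_triangle B A C : frob (A - C) <= frob (A - B) + frob (B - C).
Proof. by rewrite -[A - C](subrKA B) frobD. Qed.

End Bilinear.

Lemma frob_dot_mull l m n (X : 'M[R]_(n, l)) (A : 'M[R]_(l, m)) B :
  frob_dot (X *m A) B = frob_dot A (X^T *m B).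
Proof. by rewrite /frob_dot trmx_mul mulmxA. Qed.

Lemma frob_dot_mulr l m n (A : 'M[R]_(l, m)) (Y : 'M[R]_(m, n)) B :
  frob_dot (A *m Y) B = frob_dot A (B *m Y^T).
Proof. by rewrite /frob_dot trmx_mul -mulmxA mxtrace_mulC mulmxA. Qed.

Lemma frob_tr l m (A : 'M[R]_(l, m)) : frob A^T = frob A.
Proof. by rewrite /frob /frob_dot trmxK mxtrace_mulC. Qed.

Lemma frob_orthl l m (U : 'M[R]_l) (A : 'M[R]_(l, m)) :
  U^T *m U = 1%:M -> frob (U *m A) = frob A.
Proof. by move=> UU; rewrite /frob frob_dot_mull mulmxA UU mul1mx. Qed.

Lemma frob_orthr l m (V : 'M[R]_m) (A : 'M[R]_(l, m)) :
  V^T *m V = 1%:M -> frob (A *m V^T) = frob A.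
Proof. by move=> VV; rewrite /frob frob_dot_mulr trmxK -mulmxA VV mulmx1. Qed.

Lemma frob_dot_rows l m (A B : 'M[R]_(l, m)) :
  frob_dot A B = \sum_i frob_dot (row i A) (row i B).
Proof.
rewrite frob_dotE; apply: eq_bigr => i _; rewrite frob_dotE big_ord1.
by apply: eq_bigr => j _; rewrite !mxE.
Qed.

Lemma frob_mul l m n (A : 'M[R]_(l, m)) (B : 'M[R]_(m, n)) :
  frob (A *m B) <= frob A * frob B.
Proof.
apply: le_frob_sqr; first by rewrite mulr_ge0 ?frob_ge0.
rewrite exprMn !sqr_frob (frob_dot_rows A) -(trmxK B).
rewrite -(sqr_frob B^T^T) frob_tr sqr_frob (frob_dot_rows B^T) frob_dotE.
rewrite mulr_suml; apply: ler_sum => i _; rewrite mulr_sumr.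
apply: ler_sum => j _.
have -> : (A *m B^T^T) i j = frob_dot (row i A) (row j B^T).
  rewrite trmxK mxE frob_dotE big_ord1.
  by apply: eq_bigr => k _; rewrite !mxE.
rewrite -!sqr_frob -exprMn -expr2 -real_normK ?num_real //.
by rewrite ler_pXn2r ?nnegrE ?mulr_ge0 ?frob_ge0 // frob_CS.
Qed.

End Frobenius.

(** * Equivalence of the Frobenius norm and the sup norm *)

Section FrobeniusTopology.
Context {R : realType} {l m : nat}.
Implicit Types A B : 'M[R]_(l, m).

Lemma mx_norm_le_frob A : `|A| <= frob A.
Proof.
rewrite /Num.Def.normr/= mx_normrE; apply: bigmax_le => [|ij _].
  exact: frob_ge0.
exact: entry_le_frob.
Qed.

Lemma frob_le_mx_norm A : frob A <= (l * m)%:R * `|A|.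
Proof.
apply: frob_le_entries => // i j.
rewrite /Num.Def.normr/= mx_normrE.
exact: (le_bigmax _ (fun ij : 'I_l * 'I_m => `|A ij.1 ij.2|) (i, j)).
Qed.

Lemma nbhs_frobP A (P : set 'M[R]_(l, m)) :
  nbhs A P <-> exists2 e, 0 < e & forall B, frob (B - A) < e -> P B.
Proof.
split=> [/nbhs_normP[e /= e0 AP]|[e e0 AP]].
  exists e => // B Be; apply: AP => /=.
  by rewrite distrC (le_lt_trans (mx_norm_le_frob _)).
(* The successor keeps the constant positive for empty matrices. *)
have c0 : 0 < (l * m).+1%:R :> R by [].
rewrite -filter_from_norm_nbhs; exists (e / (l * m).+1%:R).
  by rewrite /= divr_gt0.
move=> B /= AB; apply: AP; apply: le_lt_trans (frob_le_mx_norm _) _.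
rewrite distrC in AB; rewrite ltr_pdivlMr // in AB.
apply: le_lt_trans AB; rewrite mulrC ler_wpM2l ?normr_ge0 // ler_nat.
exact: leqnSn.
Qed.

Lemma cvg_frobP T (F : set_system T) {FF : Filter F} (f : T -> 'M[R]_(l, m)) A :
  f @ F --> A <-> forall e, 0 < e -> \forall x \near F, frob (f x - A) < e.
Proof.
split=> [fA e e0|fA P /nbhs_frobP[e e0 AP]]; last first.
  by apply: filterS (fA _ e0) => x; exact: AP.
by apply: (fA [set B | frob (B - A) < e]); apply/nbhs_frobP; exists e.
Qed.

End FrobeniusTopology.

(** * Limits of products, and compact sets of matrices *)

Section MatrixLimits.
Context {R : realType}.

(** Shared by the matrix product and the inner product: in both cases fg - AB = (f - A) g + A (g -
    B). *)
Lemma cvg_bilinear_error T (F : set_system T) {FF : Filter F} l m l' m'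
    (f : T -> 'M[R]_(l, m)) (g : T -> 'M[R]_(l', m'))
    (A : 'M[R]_(l, m)) (B : 'M[R]_(l', m')) :
  f @ F --> A -> g @ F --> B -> forall e, 0 < e -> \forall x \near F,
    frob (f x - A) * frob (g x) + frob A * frob (g x - B) < e.
Proof.
move=> /cvg_frobP fA /cvg_frobP gB e e0.
have A0 := frob_ge0 A; have B0 := frob_ge0 B.
pose d := e / (frob A + frob B + 2).
have s0 : 0 < frob A + frob B + 2 by lra.
have d0 : 0 < d by rewrite divr_gt0.
near=> x.
have f1 : frob (f x - A) < d by near: x; exact: fA.
have g1 : frob (g x - B) < d by near: x; exact: gB.
have g2 : frob (g x - B) < 1 by near: x; exact: gB.
have g3 : frob (g x) <= frob B + 1.
  by have := frobD (g x - B) B; rewrite subrK; lra.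
have -> : e = d * (frob A + frob B + 2) by rewrite /d divfK // gt_eqF.
have := frob_ge0 (f x - A); have := frob_ge0 (g x - B); have := frob_ge0 (g x).
nra.
Unshelve. all: by end_near. Qed.

Lemma cvg_mulmx T (F : set_system T) {FF : Filter F} l m n
    (f : T -> 'M[R]_(l, m)) (g : T -> 'M[R]_(m, n))
    (A : 'M[R]_(l, m)) (B : 'M[R]_(m, n)) :
  f @ F --> A -> g @ F --> B -> f x *m g x @[x --> F] --> A *m B.
Proof.
move=> fA gB; apply/cvg_frobP => e e0.
apply: filterS (cvg_bilinear_error fA gB e0) => x; apply: le_lt_trans.
rewrite (_ : _ - _ = (f x - A) *m g x + A *m (g x - B)); last first.
  by rewrite mulmxBl mulmxBr addrA subrK.
by apply: le_trans (frobD _ _) _; rewrite lerD // frob_mul.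
Qed.

Lemma cvg_frob_dot T (F : set_system T) {FF : Filter F} l m
    (f g : T -> 'M[R]_(l, m)) (A B : 'M[R]_(l, m)) :
  f @ F --> A -> g @ F --> B ->
  frob_dot (f x) (g x) @[x --> F] --> frob_dot A B.
Proof.
move=> fA gB; apply/cvgrPdist_lt => e e0.
apply: filterS (cvg_bilinear_error fA gB e0) => x; apply: le_lt_trans.
rewrite distrC (_ : _ - _ = frob_dot (f x - A) (g x) + frob_dot A (g x - B)).
  by apply: le_trans (ler_normD _ _) _; rewrite lerD // frob_CS.
by rewrite frob_dotBl frob_dotBr; ring.
Qed.

Lemma cvg_trmx T (F : set_system T) {FF : Filter F} l m
    (f : T -> 'M[R]_(l, m)) (A : 'M[R]_(l, m)) :
  f @ F --> A -> (f x)^T @[x --> F] --> A^T.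
Proof.
move=> /cvg_frobP fA; apply/cvg_frobP => e e0.
by apply: filterS (fA _ e0) => x; rewrite -linearB frob_tr.
Qed.

Lemma compact_mx_box l m (c : R) :
  compact [set A : 'M[R]_(l, m) | forall i j, `|A i j| <= c].
Proof.
pose K := [set v : 'rV[R]_(l * m) | forall k, v ord0 k \in `[- c, c]].
have cK : compact K.
  apply: (@rV_compact _ _ (fun=> `[- c, c]%classic)) => _.
  exact: segment_compact.
have -> : [set A : 'M[R]_(l, m) | forall i j, `|A i j| <= c] = vec_mx @` K.
  apply/seteqP; split=> [A Ac|_ [v vK <-] i j]; last first.
    by rewrite mxE; have := vK (mxvec_index i j); rewrite in_itv /= ler_norml.
  exists (mxvec A); last exact: mxvecK.
  move=> k; case/mxvec_indexP: k => i j.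
  by rewrite mxvecE in_itv /= -ler_norml.
apply: continuous_compact cK; apply: continuous_subspaceT => v.
apply/(@cvgrPdist_lt _ _ _ (nbhs v) (nbhs_filter v)) => e e0.
have /filterS : nbhs v [set w | `|v - w| < e].
  apply/nbhs_frobP; exists e => // w; rewrite frobBC.
  exact: le_lt_trans (mx_norm_le_frob _).
apply=> w; apply: le_lt_trans.
rewrite [leLHS]/Num.Def.normr/= mx_normrE; apply: bigmax_le => [|[i j] _] //=.
rewrite -linearB mxE [leRHS]/Num.Def.normr/= mx_normrE.
exact: (le_bigmax _ (fun ij : 'I_1 * 'I_(l * m) => `|(v - w) ij.1 ij.2|)
  (ord0, mxvec_index i j)).
Qed.

Lemma compact_frob_ball l m (c : R) :
  compact [set A : 'M[R]_(l, m) | frob A <= c].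
Proof.
apply: subclosed_compact (@compact_mx_box l m c) _; last first.
  by move=> A /= Ac i j; exact: le_trans (entry_le_frob _ _ _) Ac.
apply: (@preimage_closed _ R^o (@frob R l m) [set x | x <= c]); last first.
  exact: closed_le.
move=> A _; have cA : frob_dot B B @[B --> A] --> frob_dot A A.
  have idA : id B @[B --> A] --> A by exact: cvg_id.
  refine (cvg_frob_dot idA idA).
exact: continuous_cvg (@sqrt_continuous R _) cA.
Qed.

Definition orthogonal_mx n : set 'M[R]_n := [set U | U^T *m U = 1%:M].

(** Closed as the zero set of the continuous [h], and bounded because the columns of an orthogonal
    matrix are unit vectors. *)
Lemma compact_orthogonal_mx n : compact (@orthogonal_mx n).
Proof.
pose h (U : 'M[R]_n) := frob_dot (U^T *m U - 1%:M) (U^T *m U - 1%:M).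
have -> : @orthogonal_mx n = h @^-1` [set x | x = 0].
  apply/seteqP; split=> U /= => [UU|].
    by rewrite /h UU subrr frob_dot0r.
  rewrite /h -sqr_frob => /eqP; rewrite sqrf_eq0 => /eqP /frob_eq0 /eqP.
  by rewrite subr_eq0 => /eqP.
apply: subclosed_compact (@compact_mx_box n n 1) _; last first.
  move=> U /= hU i j.
  have /eqP : h U = 0 by [].
  rewrite /h -sqr_frob sqrf_eq0 => /eqP /frob_eq0 /eqP.
  rewrite subr_eq0 => /eqP /matrixP /(_ j j); rewrite !mxE eqxx mulr1n => UU.
  rewrite -(@ler_pXn2r _ 2) ?nnegrE // real_normK ?num_real // expr1n -UU.
  rewrite (bigD1 i) //= mxE -expr2 lerDl; apply: sumr_ge0 => k _.
  by rewrite mxE -expr2 sqr_ge0.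
apply: (@preimage_closed _ R^o h [set x | x = 0]); last exact: closed_eq.
move=> U _.
have cvU : V^T *m V - 1%:M @[V --> U] --> U^T *m U - 1%:M.
  have idU : id V @[V --> U] --> U by exact: cvg_id.
  have /cvg_frobP UU : V^T *m V @[V --> U] --> U^T *m U.
    exact: cvg_mulmx (cvg_trmx idU) idU.
  apply/(@cvg_frobP _ _ _ _ (nbhs U) (nbhs_filter U)) => e e0.
  apply: filterS (UU e e0) => V.
  by rewrite opprB addrA subrK.
exact: (cvg_frob_dot cvU cvU).
Qed.

End MatrixLimits.

(** * Rectangular diagonal matrices *)

Section RectDiag.
Context {R : realType}.
Implicit Types (s t : nat -> R).

Lemma rect_diag_tr l m s : (rect_diag l m s)^T = rect_diag m l s.
Proof.
apply/matrixP => i j; rewrite !mxE eq_sym.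
by case: eqP => [->|].
Qed.

Lemma mul_rect_diagE n l m s (X : 'M[R]_(l, m)) (i : 'I_n) j (i' : 'I_l) :
  i = i' :> nat -> (rect_diag n l s *m X) i j = s i * X i' j.
Proof.
move=> ii'; rewrite mxE (bigD1 i') //= mxE ii' eqxx mulr1n.
rewrite big1 ?addr0 // => k ki'; rewrite mxE ii' eq_sym.
by rewrite (inj_eq val_inj) (negPf ki') mul0r.
Qed.

(** The inner dimension m cuts off all indices from m on, whence the condition on s. *)
Lemma rect_diag_mul l m n s t : (forall k, (m <= k)%N -> s k = 0) ->
  rect_diag l m s *m rect_diag m n t = rect_diag l n (fun k => s k * t k).
Proof.
move=> s0; apply/matrixP => i j; have [im|mi] := ltnP i m.
  by rewrite (@mul_rect_diagE _ _ _ _ _ _ _ (Ordinal im)) // !mxE /= mulrnAr.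
rewrite [RHS]mxE s0 // mul0r mul0rn mxE big1 // => k _.
by rewrite mxE s0 // mul0rn mul0r.
Qed.

End RectDiag.

(** * Singular value decomposition *)

Section SVDExistence.
Context {R : realType}.

Lemma orthogonal_mx_tr n (U : 'M[R]_n) : orthogonal_mx U -> orthogonal_mx U^T.
Proof. by rewrite /orthogonal_mx /= trmxK => /mulmx1C. Qed.

Lemma orthogonal_mx_mul n (U V : 'M[R]_n) :
  orthogonal_mx U -> orthogonal_mx V -> orthogonal_mx (U *m V).
Proof.
rewrite /orthogonal_mx /= => UU VV.
by rewrite trmx_mul mulmxA -(mulmxA V^T) UU mulmx1.
Qed.

(** A Householder reflection when a |u|^2 = 2; the free factor [a] spares the normalization of u. *)
Definition reflection n (a : R) (u : 'cV[R]_n) : 'M[R]_n :=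
  1%:M - a *: (u *m u^T).

Lemma orthogonal_reflection n a (u : 'cV[R]_n) :
  a * (u^T *m u) 0 0 = 2 -> orthogonal_mx (reflection a u).
Proof.
rewrite /orthogonal_mx /= /reflection => au.
rewrite [(_ - _)^T]linearB /= linearZ /= trmx_mul trmxK tr_scalar_mx.
rewrite mulmxBl mul1mx mulmxBr mulmx1 -scalemxAl -scalemxAr scalerA.
rewrite mulmxA -(mulmxA u) (mx11_scalar (u^T *m u)) mul_mx_scalar -scalemxAl.
rewrite scalerA -mulrA au -scalerBl addrAC -addrA -opprD -scalerDl.
by rewrite (_ : a - a * 2 + a = 0) ?scale0r ?subr0 //; ring.
Qed.

Lemma mxtrace_mul_outer n (M : 'M[R]_n) (u v : 'cV[R]_n) :
  \tr (M *m (u *m v^T)) = (v^T *m M *m u) 0 0.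
Proof. by rewrite mulmxA mxtrace_mulC mulmxA trace_mx11. Qed.

Lemma mx_delta_entry m n (M : 'M[R]_(m, n)) i j :
  ((delta_mx i 0 : 'cV_m)^T *m M *m (delta_mx j 0 : 'cV_n)) 0 0 = M i j.
Proof. by rewrite trmx_delta -rowE -colE !mxE. Qed.

Lemma mxtrace_mul_reflection n (M : 'M[R]_n) a (u : 'cV[R]_n) :
  \tr (M *m reflection a u) = \tr M - a * (u^T *m M *m u) 0 0.
Proof.
rewrite /reflection mulmxBr mulmx1 -scalemxAr raddfB /= mxtraceZ.
by rewrite mxtrace_mul_outer.
Qed.

(* Stationarity of [tr (M G)] under plane rotations, written as products of two
   reflections: for all x, [- (M i i + M j j) <= x * (M i j - M j i)]. *)
Lemma trace_max_sym n (M : 'M[R]_n) :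
  (forall G, orthogonal_mx G -> \tr (M *m G) <= \tr M) -> M^T = M.
Proof.
move=> maxM; apply/matrixP => i j; rewrite mxE.
have [->//|ij] := eqVneq j i.
pose e (k : 'I_n) : 'cV[R]_n := delta_mx k 0.
have eNe (N : 'M[R]_n) (k k1 : 'I_n) : ((e k)^T *m N *m e k1) 0 0 = N k k1.
  exact: mx_delta_entry.
have ee (k k1 : 'I_n) : ((e k)^T *m e k1) 0 0 = (k == k1)%:R.
  by rewrite -[(e k)^T]mulmx1 eNe mxE.
have He : orthogonal_mx (reflection 2 (e i)).
  by apply: orthogonal_reflection; rewrite ee eqxx mulr1.
have key x : - (M i i + M j j) <= x * (M i j - M j i).
  (* As |w|^2 = x^2 + 1, [reflection b w] is orthogonal; its product with the reflection along [e i]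
     rotates the plane of [e i] and [e j]. *)
  pose w := x *: e i + e j; pose b := 2 / (x ^+ 2 + 1).
  have q0 : 0 < x ^+ 2 + 1 by rewrite ltr_wpDl ?sqr_ge0.
  have wM (N : 'M[R]_n) (k : 'I_n) : (w^T *m N *m e k) 0 0 = x * N i k + N j k.
    rewrite /w [(_ + _)^T]linearD linearZ /= !mulmxDl -!scalemxAl.
    by rewrite mxE mxE !eNe.
  have wMw (N : 'M[R]_n) : (w^T *m N *m w) 0 0 =
      x ^+ 2 * N i i + x * (N i j + N j i) + N j j.
    rewrite {2}/w mulmxDr -scalemxAr mxE mxE !wM; ring.
  have ww : (w^T *m w) 0 0 = x ^+ 2 + 1.
    rewrite -[w^T]mulmx1 wMw !mxE !eqxx (negPf ij).
    by rewrite eq_sym (negPf ij) /=; ring.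
  have Hw : orthogonal_mx (reflection b w).
    by apply: orthogonal_reflection; rewrite ww divfK // gt_eqF.
  have := maxM _ (orthogonal_mx_mul He Hw).
  rewrite mulmxA !mxtrace_mul_reflection wMw eNe.
  have MF (k k' : 'I_n) : (M *m reflection 2 (e i)) k k' =
      M k k' - 2 * (M k i * (k' == i)%:R).
    rewrite /reflection mulmxBr mulmx1 -scalemxAr mulmxA -colE.
    rewrite 2!mxE [X in _ - X]mxE mxE big_ord1 !mxE eqxx andbT.
    by rewrite eq_sym.
  rewrite !MF eqxx (negPf ij) !mulr0 !subr0 !mulr1 => H.
  have {H} : 0 <= b * (M i i + M j j + x * (M i j - M j i)).
    have bq : 2 * M i i = b * (x ^+ 2 + 1) * M i i.
      by rewrite /b divfK // gt_eqF.
    nra.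
  by rewrite pmulr_rge0 ?divr_gt0 //; lra.
apply/eqP; rewrite eq_sym -subr_eq0; apply/negP => /negP D0.
(* A linear function of x that is bounded below has slope 0: this x would violate the bound. *)
have := key (- (`|M i i + M j j| + 1) / (M i j - M j i)).
rewrite divfK //; have := ler_norm (M i i + M j j); lra.
Qed.

(* A pair of orthogonal matrices [U], [V] maximizing [tr (C U^T A V)], for a
   diagonal [C] with strictly decreasing entries, diagonalizes [A]: for
   [B = U^T A V], both [B C] and [C B] are symmetric, so that
   [c i ^+ 2 * B i j = B i j * c j ^+ 2]. *)
Section TwoSided.
Context {l m : nat} (B : 'M[R]_(l, m)) (c : nat -> R).
Context (c_decr : forall i j, (i < j)%N -> (i < minn l m)%N -> c j < c i).
Context (c0 : forall k, (minn l m <= k)%N -> c k = 0).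
Context (maxB : forall (G : 'M[R]_l) (H : 'M[R]_m),
  orthogonal_mx G -> orthogonal_mx H ->
  \tr (rect_diag m l c *m (G *m B *m H)) <= \tr (rect_diag m l c *m B)).
Let C := rect_diag m l c.

Let c_gt0 k : (k < minn l m)%N -> 0 < c k.
Proof. by move=> km; rewrite -(c0 (leqnn _)); exact: c_decr. Qed.

Let orth1 n : @orthogonal_mx R n 1%:M.
Proof. by rewrite /orthogonal_mx /= trmx1 mulmx1. Qed.

Let BCE (i j : 'I_l) (j' : 'I_m) : j' = j :> nat -> (B *m C) i j = B i j' * c j.
Proof.
move=> jj'; rewrite -[B *m C]trmxK mxE trmx_mul rect_diag_tr.
by rewrite (@mul_rect_diagE _ _ _ _ _ _ _ _ j') ?mxE 1?mulrC.
Qed.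

Let CBE (i j : 'I_m) (i' : 'I_l) : i = i' :> nat -> (C *m B) i j = c i * B i' j.
Proof. exact: mul_rect_diagE. Qed.

Let maxBC (G : 'M[R]_l) :
  orthogonal_mx G -> \tr ((B *m C) *m G) <= \tr (B *m C).
Proof.
move=> GG; have := maxB GG (@orth1 m).
by rewrite mulmx1 !(mxtrace_mulC C) (mxtrace_mulC _ G) -mulmxA.
Qed.

Let maxCB (H : 'M[R]_m) :
  orthogonal_mx H -> \tr ((C *m B) *m H) <= \tr (C *m B).
Proof. by move=> HH; have := maxB (@orth1 l) HH; rewrite mul1mx mulmxA. Qed.

Lemma maximizer_offdiag (i : 'I_l) (j : 'I_m) : i <> j :> nat -> B i j = 0.
Proof.
move=> ij; have symBC := trace_max_sym maxBC; have symCB := trace_max_sym maxCB.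
have sq k : (minn l m <= k)%N -> c k * c k = 0 by move/c0->; rewrite mul0r.
have : (C^T *m C *m B) i j = (B *m (C *m C^T)) i j.
  have CB : C *m B = B^T *m C^T by rewrite -trmx_mul symCB.
  have BC : C^T *m B^T = B *m C by rewrite -trmx_mul symBC.
  by rewrite -mulmxA CB mulmxA BC mulmxA.
rewrite rect_diag_tr !rect_diag_mul; last 2 first.
- by move=> k mk; apply: c0; rewrite geq_min mk.
- by move=> k mk; apply: c0; rewrite geq_min mk orbT.
rewrite (@mul_rect_diagE _ _ _ _ _ _ _ _ i) //.
rewrite -[_ *m rect_diag _ _ _]trmxK mxE trmx_mul rect_diag_tr.
rewrite (@mul_rect_diagE _ _ _ _ _ _ _ _ j) // mxE => /eqP.
rewrite -subr_eq0 -mulrBl mulf_eq0 => /orP[|/eqP//].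
rewrite -!expr2 subr_sqr mulf_eq0.
have cnn k : 0 <= c k.
  by have [/c_gt0/ltW//|/c0->] := ltnP k (minn l m).
(* The smaller of two distinct indices lies below [minn l m], where c is positive and strictly
   decreasing; hence c i and c j differ and their sum is positive. *)
have : (i < minn l m)%N || (j < minn l m)%N.
  have := ltn_ord i; have := ltn_ord j; rewrite !ltn_min.
  by case: ltnP; case: ltnP => //; lia.
move: ij => /eqP; rewrite neq_ltn => /orP[ij|ji] /orP ilt.
  have im : (i < minn l m)%N by case: ilt => //; apply: ltn_trans.
  rewrite subr_eq0 gt_eqF ?c_decr //= gt_eqF // ltr_pwDl ?c_gt0 //.
have jm : (j < minn l m)%N by case: ilt => //; apply: ltn_trans.
by rewrite subr_eq0 lt_eqF ?c_decr //= gt_eqF // ltr_wpDl ?c_gt0.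
Qed.

(** The reflection along the i-th basis vector flips the sign of row i of B, which lowers the trace
    by 2 c i B i j. *)
Lemma maximizer_diag_ge0 (i : 'I_l) (j : 'I_m) : i = j :> nat -> 0 <= B i j.
Proof.
move=> ij; pose e : 'cV[R]_l := delta_mx i 0.
have im : (i < minn l m)%N by rewrite ltn_min ltn_ord ij ltn_ord.
have He : orthogonal_mx (reflection 2 e).
  apply: orthogonal_reflection.
  by rewrite -[e^T]mulmx1 mx_delta_entry mxE eqxx mulr1.
have := maxBC He; rewrite mxtrace_mul_reflection mx_delta_entry.
rewrite (BCE _ (esym ij)).
by rewrite gerBl pmulr_rge0 // pmulr_lge0 // c_gt0.
Qed.

(** The reflections along u and v are transpositions, which swap two diagonal entries of B.
    Optimality becomes the rearrangement inequality (c i1 - c i2) (B i1 j1 - B i2 j2) >= 0. *)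
Lemma maximizer_diag_sorted (i1 i2 : 'I_l) (j1 j2 : 'I_m) :
  i1 = j1 :> nat -> i2 = j2 :> nat -> (i1 < i2)%N -> B i2 j2 <= B i1 j1.
Proof.
move=> ij1 ij2 i12.
pose u : 'cV[R]_l := delta_mx i1 0 - delta_mx i2 0.
pose v : 'cV[R]_m := delta_mx j1 0 - delta_mx j2 0.
have quad n p (N : 'M[R]_(n, p)) a1 a2 b1 b2 :
    ((delta_mx a1 0 - delta_mx a2 0 : 'cV_n)^T *m N *m
     (delta_mx b1 0 - delta_mx b2 0 : 'cV_p)) 0 0 =
    N a1 b1 - N a2 b1 - (N a1 b2 - N a2 b2).
  have sub00 (X Y : 'M[R]_1) : (X - Y) 0 0 = X 0 0 - Y 0 0 by rewrite !mxE.
  rewrite [(_ - _)^T]linearB /= mulmxBl !mulmxBr !mulmxBl.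
  by rewrite !sub00 !mx_delta_entry.
have n12 : i1 != i2 by apply: contraTneq i12 => ->; rewrite ltnn.
have m12 : j1 != j2 by apply: contraTneq i12 => jj; rewrite ij1 ij2 jj ltnn.
have Hu : orthogonal_mx (reflection 1 u).
  apply: orthogonal_reflection; rewrite -[u^T]mulmx1 quad !mxE !eqxx.
  by rewrite (negPf n12) (eq_sym i2) (negPf n12) /=; ring.
have Hv : orthogonal_mx (reflection 1 v).
  apply: orthogonal_reflection; rewrite -[v^T]mulmx1 quad !mxE !eqxx.
  by rewrite (negPf m12) (eq_sym j2) (negPf m12) /=; ring.
have := maxB Hu Hv.
have trCB : \tr (C *m reflection 1 u *m B) =
    \tr (C *m B) - (u^T *m (B *m C) *m u) 0 0.
  by rewrite [LHS]mxtrace_mulC [in LHS]mulmxA mxtrace_mul_reflection mul1r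
    (mxtrace_mulC C).
rewrite -/C !mulmxA mxtrace_mul_reflection trCB mul1r -addrA gerDl.
have expand (w : 'cV[R]_l) (z : 'cV[R]_m) :
    z^T *m (C *m reflection 1 w *m B) *m z =
    z^T *m (C *m B) *m z - (z^T *m C *m w) *m (w^T *m B *m z).
  rewrite /reflection scale1r (mulmxBr C) mulmx1 mulmxBl mulmxBr mulmxBl.
  by rewrite !mulmxA.
rewrite expand.
have sub00 (X Y Z : 'M[R]_1) : (X - Y *m Z) 0 0 = X 0 0 - Y 0 0 * Z 0 0.
  by rewrite !mxE big_ord1.
rewrite sub00 !quad !(BCE _ (esym ij1)) !(BCE _ (esym ij2)).
rewrite !(CBE _ (esym ij1)) !(CBE _ (esym ij2)).
rewrite -!ij1 -!ij2.
have C12 : (i1 == i2 :> nat) = false by rewrite (ltn_eqF i12).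
have B12 : B i1 j2 = 0 by apply: maximizer_offdiag; rewrite -ij2; lia.
have B21 : B i2 j1 = 0 by apply: maximizer_offdiag; rewrite -ij1; lia.
have C11 : C j1 i1 = c i1 by rewrite !mxE -ij1 eqxx.
have C22 : C j2 i2 = c i2 by rewrite !mxE -ij2 eqxx.
have C21 : C j2 i1 = 0 by rewrite !mxE -ij2 eq_sym C12.
have C12' : C j1 i2 = 0 by rewrite !mxE -ij1 C12.
rewrite B12 B21 C11 C22 C21 C12'.
have : c i2 < c i1 by apply: c_decr => //; rewrite ltn_min ltn_ord ij1 ltn_ord.
nra.
Qed.

End TwoSided.

End SVDExistence.

Section SVDExists.
Context {R : realType} {l m : nat}.

Lemma exists_trace_maximizer (A D : 'M[R]_(l, m)) :
  exists U V, [/\ orthogonal_mx U, orthogonal_mx V &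
    forall U' V', orthogonal_mx U' -> orthogonal_mx V' ->
      frob_dot D (U'^T *m A *m V') <= frob_dot D (U^T *m A *m V)].
Proof.
pose K := @orthogonal_mx R l `*` @orthogonal_mx R m.
pose f (p : 'M[R]_l * 'M[R]_m) := frob_dot D (p.1^T *m A *m p.2).
have cK : compact K by apply: compact_setX; exact: compact_orthogonal_mx.
have orth1 n : @orthogonal_mx R n 1%:M.
  by rewrite /orthogonal_mx /= trmx1 mulmx1.
have K0 : K !=set0 by exists (1%:M, 1%:M); split; exact: orth1.
have cf : {within K, continuous (f : _ -> R)}.
  apply: continuous_subspaceT => p.
  have p1 : q.1 @[q --> p] --> p.1 by exact: cvg_fst.
  have p2 : q.2 @[q --> p] --> p.2 by exact: cvg_snd.
  have cA (X : 'M[R]_(l, m)) : X @[q --> p] --> X by exact: cvg_cst.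
  exact: (cvg_frob_dot (cA D) (cvg_mulmx (cvg_mulmx (cvg_trmx p1) (cA A)) p2)).
have [[U V]] := compact_EVT_max K0 cK cf; rewrite inE => -[/= UU VV] maxf.
exists U, V; split=> // U' V' UU' VV'.
by apply: (maxf (U', V')); rewrite inE.
Qed.

Lemma svd_exists (A : 'M[R]_(l, m)) : exists U s V, is_svd A U s V.
Proof.
(* Truncated subtraction makes c strictly decreasing below [minn l m] and zero from there on. *)
pose c k : R := (minn l m - k)%:R.
have [U [V [UU VV maxUV]]] := exists_trace_maximizer A (rect_diag l m c).
pose B := U^T *m A *m V.
have c_decr i j : (i < j)%N -> (i < minn l m)%N -> c j < c i.
  by rewrite /c ltr_nat; lia.
have c0 k : (minn l m <= k)%N -> c k = 0 by rewrite /c -subn_eq0 => /eqP->.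
have maxB G H : orthogonal_mx G -> orthogonal_mx H ->
    \tr (rect_diag m l c *m (G *m B *m H)) <= \tr (rect_diag m l c *m B).
  move=> GG HH; have := maxUV (U *m G^T) (V *m H) (orthogonal_mx_mul UU
    (orthogonal_mx_tr GG)) (orthogonal_mx_mul VV HH).
  by rewrite /frob_dot rect_diag_tr trmx_mul trmxK /B !mulmxA.
pose s k := oapp (fun i => oapp (B i) 0 (insub k : option 'I_m)) 0
  (insub k : option 'I_l).
have sE (i : 'I_l) (j : 'I_m) : i = j :> nat -> s i = B i j.
  by move=> ij; rewrite /s valK /= ij valK.
have s0 k : (minn l m <= k)%N -> s k = 0.
  rewrite /s geq_min => klm; case: (@insubP _ _ 'I_l k) => //= i il _.
  case: (@insubP _ _ 'I_m k) => //= j jm _; move: klm.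
  by rewrite leqNgt il leqNgt jm.
have UU' : U *m U^T = 1%:M by exact: mulmx1C.
have VV' : V *m V^T = 1%:M by exact: mulmx1C.
exists U, s, V; split=> //.
- move=> i j; rewrite leq_eqVlt => /predU1P[->//|ij].
  have [jm|/s0->] := ltnP j (minn l m); last first.
    have [im|/s0->//] := ltnP i (minn l m).
    move: (im); rewrite ltn_min => /andP[il im'].
    rewrite (@sE (Ordinal il) (Ordinal im')) //.
    exact: (maximizer_diag_ge0 c_decr c0 maxB).
  move: (jm) (ltn_trans ij jm); rewrite !ltn_min => /andP[jl jm'] /andP[il im'].
  rewrite (@sE (Ordinal il) (Ordinal im')) //.
  rewrite (@sE (Ordinal jl) (Ordinal jm')) //.
  exact: (maximizer_diag_sorted c_decr c0 maxB).
- have -> : rect_diag l m s = B.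
    apply/matrixP => i j; rewrite mxE; have [ij|/eqP ij] := eqVneq (i : nat) j.
      by rewrite mulr1n (sE i j ij).
    by rewrite mulr0n (maximizer_offdiag c_decr c0 maxB).
  by rewrite /B !mulmxA UU' mul1mx -mulmxA VV' mulmx1.
Qed.

End SVDExists.

(** * Truncations of a singular value decomposition *)

Section SVDTheory.
Context {R : realType} {l m : nat}.
Implicit Types (A B C : 'M[R]_(l, m)) (s : nat -> R).

Lemma is_svd_ge0 A U s V : is_svd A U s V -> forall k, 0 <= s k.
Proof.
case=> _ _ sd s0 _ k.
by rewrite -(s0 (maxn k (minn l m))) ?leq_maxr // sd // leq_maxl.
Qed.

(** A predicate instead of a bound on the index gives the truncation and its defect the same
    form. *)
Definition svd_cut (U : 'M[R]_l) s (V : 'M[R]_m) (P : pred nat) :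
  'M[R]_(l, m) :=
  U *m rect_diag l m (fun k => if P k then s k else 0) *m V^T.

Lemma frob_svd_cut U s V (P : pred nat) e :
  U^T *m U = 1%:M -> V^T *m V = 1%:M -> 0 <= e ->
  (forall k, P k -> `|s k| <= e) ->
  frob (svd_cut U s V P) <= (l * m)%:R * e.
Proof.
move=> UU VV e0 se; rewrite frob_orthr // frob_orthl //.
apply: frob_le_entries => // i j; rewrite mxE.
by case: eqP => _; rewrite ?mulr0n ?normr0 // mulr1n; case: ifP => [/se|_];
  rewrite ?normr0.
Qed.

Lemma svd_cutC A U s V P : is_svd A U s V ->
  A - svd_cut U s V P = svd_cut U s V (predC P).
Proof.
case=> _ _ _ _ {1}->; rewrite /svd_cut -mulmxBl -mulmxBr; congr (_ *m _ *m _).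
apply/matrixP => i j; rewrite !mxE /=.
by case: eqP => _; rewrite ?mulr0n ?subr0 // !mulr1n; case: (P i);
  rewrite /= ?subrr ?subr0.
Qed.

(** Singular vectors with indices in complementary sets are orthogonal; for P = (k < r) this is the
    normality of the truncation defect. *)
Lemma svd_cut_normal A U s V P : is_svd A U s V ->
  (svd_cut U s V P)^T *m svd_cut U s V (predC P) = 0 /\
  svd_cut U s V (predC P) *m (svd_cut U s V P)^T = 0.
Proof.
case=> UU VV _ s0 _; rewrite /svd_cut !trmx_mul !trmxK rect_diag_tr.
have diag0 n (s' : nat -> R) : (forall k, s' k = 0) -> rect_diag n n s' = 0.
  by move=> s'0; apply/matrixP => i j; rewrite !mxE s'0 mul0rn.
split.
  rewrite !mulmxA -(mulmxA _ U^T) UU mulmx1 -(mulmxA V) rect_diag_mul.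
    by rewrite diag0 ?mulmx0 ?mul0mx // => k /=; case: (P k);
      rewrite /= ?mulr0 ?mul0r.
  by move=> k lk; rewrite s0 ?if_same // geq_min lk.
rewrite !mulmxA -(mulmxA _ V^T) VV mulmx1 -(mulmxA U) rect_diag_mul.
  by rewrite diag0 ?mulmx0 ?mul0mx // => k /=; case: (P k);
    rewrite /= ?mulr0 ?mul0r.
by move=> k lk; rewrite s0 ?if_same // geq_min lk orbT.
Qed.

Lemma is_svd_unit A U s V : is_svd A U s V -> U \in unitmx /\ V^T \in unitmx.
Proof.
case=> /mulmx1_unit[_ UU] /mulmx1_unit[VV _] _ _ _; split=> //.
Qed.

Lemma mxrank_svd_cut A U s V P : is_svd A U s V ->
  \rank (svd_cut U s V P) =
  \rank (rect_diag l m (fun k => if P k then s k else 0)).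
Proof.
move=> /is_svd_unit[Uu Vu]; rewrite /svd_cut mxrankMfree; last first.
  by rewrite row_free_unit.
by rewrite (eqmxMfull _ _) // row_full_unit.
Qed.

Lemma pid_rect_diag n p r :
  pid_mx r = rect_diag n p (fun k => (k < r)%:R) :> 'M[R]_(n, p).
Proof.
by apply/matrixP => i j; rewrite !mxE; case: eqP; rewrite ?mulr1n ?mulr0n.
Qed.

Lemma mxrank_svd_cut_le A U s V r : is_svd A U s V ->
  (\rank (svd_cut U s V (fun k => k < r)%N) <= r)%N.
Proof.
move=> sA; rewrite (mxrank_svd_cut _ sA).
have [lr|/ltnW rl] := leqP l r; first exact: leq_trans (rank_leq_row _) lr.
have -> : rect_diag l m (fun k => if (k < r)%N then s k else 0) =
    pid_mx r *m rect_diag l m s.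
  rewrite pid_rect_diag rect_diag_mul; last first.
    by move=> k lk; rewrite ltnNge (leq_trans rl lk).
  congr rect_diag; apply/funext => k.
  by case: ifP => _; rewrite ?mul1r ?mul0r.
by apply: leq_trans (mxrankM_maxl _ _) _; rewrite rank_pid_mx.
Qed.

(** The gap makes the first r singular values positive, so [pid_mx r] factors through the truncated
    diagonal. *)
Lemma mxrank_svd_cut_eq A U s V r : is_svd A U s V -> s r < s r.-1 ->
  \rank (svd_cut U s V (fun k => k < r)%N) = r.
Proof.
move=> sA gap; apply/eqP; rewrite eqn_leq (mxrank_svd_cut_le _ sA) /=.
have sge := is_svd_ge0 sA; case: (sA) => _ _ sd s0 _.
(* Since [0.-1] is 0, the gap for r = 0 would compare [s 0] with itself. *)
have r0 : (0 < r)%N by case: (r) gap => //; rewrite ltxx.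
have rm : (r <= minn l m)%N.
  rewrite -(prednK r0) ltnNge; apply/negP => /s0 sr0.
  by move: gap; rewrite sr0 ltNge sge.
move: rm; rewrite leq_min => /andP[rl rm].
rewrite (mxrank_svd_cut _ sA) -{1}(@rank_pid_mx R l m r rl rm).
have -> : pid_mx r = rect_diag l m (fun k => if (k < r)%N then s k else 0)
    *m rect_diag m m (fun k => (s k)^-1).
  rewrite pid_rect_diag rect_diag_mul; last first.
    by move=> k mk; rewrite ltnNge (leq_trans rm mk).
  congr rect_diag; apply/funext => k; case: ifP => kr; last by rewrite mul0r.
  rewrite mulfV // gt_eqF // (lt_le_trans (le_lt_trans (sge r) gap)) // sd //.
  by rewrite -ltnS prednK.
exact: mxrankM_maxl.
Qed.

(* Some combination of the first [k + 1] right singular vectors is killed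
   by [C]. *)
Lemma weyl_rank A C U s V k : is_svd A U s V -> (\rank C <= k)%N ->
  s k <= frob (A - C).
Proof.
move=> sA Ck; have sge := is_svd_ge0 sA; case: (sA) => UU VV sd s0 AE.
have [km|/s0->] := ltnP k (minn l m); last exact: frob_ge0.
move: km; rewrite leq_min => /andP[kl km].
pose J n : 'M[R]_(k.+1, n) := rect_diag k.+1 n (fun i => (i < k.+1)%:R).
pose D : 'M[R]_k.+1 := rect_diag k.+1 k.+1 (fun i => s i * (i < k.+1)%:R).
have JJ n : (k < n)%N -> J n *m (J n)^T = 1%:M.
  move=> kn; rewrite rect_diag_tr rect_diag_mul; last first.
    by move=> i ni; rewrite ltnNge (leq_trans kn ni).
  by apply/matrixP => i j; rewrite !mxE ltn_ord mulr1.
have frobJ n (x : 'rV[R]_k.+1) : (k < n)%N -> frob (x *m J n) = frob x.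
  by move=> kn; rewrite /frob frob_dot_mulr -mulmxA JJ // mulmx1.
have JD : J m *m rect_diag m l s = D *m J l.
  rewrite !rect_diag_mul.
  - congr rect_diag; apply/funext => i.
    by case: ltnP; rewrite /= ?mulr1 ?mul1r ?mul0r ?mulr0.
  - by move=> i ki; rewrite ltnNge ki mulr0.
  - by move=> i mi; rewrite ltnNge (leq_trans km mi).
(* This matrix has k + 1 rows and rank at most [\rank C <= k]. *)
have : kermx (J m *m V^T *m C^T) != 0.
  rewrite kermx_eq0 /row_free neq_ltn; apply/orP; left.
  apply: leq_ltn_trans (mxrankM_maxr _ _) _.
  by rewrite mxrank_tr.
case/rowV0Pn => x /sub_kermxP xC x0.
have xgt : 0 < frob x.
  by rewrite lt_def frob_ge0 andbT; apply: contraNneq x0 => /frob_eq0->.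
rewrite -(ler_pM2l xgt).
have -> : frob x = frob (x *m J m *m V^T) by rewrite frob_orthr // frobJ.
rewrite -(frob_tr (A - C)); apply: le_trans (frob_mul _ _).
have -> : x *m J m *m V^T *m (A - C)^T = x *m (D *m J l) *m U^T.
  have xC0 : x *m J m *m V^T *m C^T = 0 by rewrite -xC !mulmxA.
  rewrite [(A - C)^T]linearB /= mulmxBr xC0 subr0 AE.
  rewrite !trmx_mul trmxK rect_diag_tr -JD.
  by rewrite -!mulmxA (mulmxA V^T) VV mul1mx.
rewrite !frob_orthr // (mulmxA x) !frobJ // mulrC.
rewrite -(@ler_pXn2r _ 2) ?nnegrE ?frob_ge0 ?mulr_ge0 ?frob_ge0 //.
rewrite exprMn !sqr_frob !frob_dotE !big_ord1 mulr_sumr.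
apply: ler_sum => i _.
have -> : (x *m D) 0 i = s i * x 0 i.
  rewrite -[x *m D]trmxK mxE trmx_mul rect_diag_tr.
  rewrite (@mul_rect_diagE _ _ _ _ _ _ _ _ i) //.
  by rewrite mxE ltn_ord mulr1.
rewrite -!expr2 exprMn ler_wpM2r ?sqr_ge0 // ler_pXn2r ?nnegrE //.
by rewrite sd // -ltnS.
Qed.

End SVDTheory.

(** * Geometry of the fixed rank manifold *)

Section FixedRankGeometry.
Context {R : realType}.

(** If v (1 + X) = 0 then |v| = |v X| <= |v| / 2. The inverse Y satisfies Y = 1 - X Y, so |Y| <= |1|
    + |Y| / 2; the Frobenius norm of 1 remains in the bound. *)
Lemma unitmx_neumann n (X : 'M[R]_n) : frob X <= 2^-1 ->
  1%:M + X \in unitmx /\ frob (invmx (1%:M + X)) <= 2 * frob (1%:M : 'M[R]_n).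
Proof.
move=> X2; have Xu : 1%:M + X \in unitmx.
  rewrite -row_free_unit -kermx_eq0; apply/rowV0P => v /sub_kermxP.
  rewrite mulmxDr mulmx1 => /eqP; rewrite addr_eq0 => /eqP vX.
  apply: frob_eq0; have := frob_mul v X; rewrite -(frobN (v *m X)) -vX.
  by have := frob_ge0 v; nra.
split=> //; have := mulmxV Xu; set Y := invmx _; rewrite mulmxDl mul1mx => XY.
have : frob Y <= frob (1%:M : 'M[R]_n) + frob (X *m Y).
  by rewrite -XY; apply: le_trans (frobB_le _ _); rewrite addrK.
by have := frob_mul X Y; have := frob_ge0 Y; nra.
Qed.

Context {l m : nat}.
Implicit Types (A B C N L : 'M[R]_(l, m)) (G : 'M[R]_(m, l)).

(** An algebraic form of orthogonality to the tangent space at A, free of curves; [tangent_normal]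
    and [orth_proj_tangent] make the link. *)
Definition normal_mx A N := A^T *m N = 0 /\ N *m A^T = 0.

Lemma normal_dot_mull A N (Y : 'M[R]_m) :
  normal_mx A N -> frob_dot N (A *m Y) = 0.
Proof.
by case=> AN _; rewrite frob_dotC /frob_dot trmx_mul -mulmxA AN mulmx0 mxtrace0.
Qed.

Lemma normal_dot_mulr A N (X : 'M[R]_l) :
  normal_mx A N -> frob_dot N (X *m A) = 0.
Proof.
case=> _ NA; rewrite frob_dotC /frob_dot trmx_mul -mulmxA mxtrace_mulC -mulmxA.
by rewrite NA mulmx0 mxtrace0.
Qed.

Lemma normal_dotxx A N : normal_mx A N -> frob_dot N A = 0.
Proof. by move=> NA; rewrite -(mulmx1 A) normal_dot_mull. Qed.

(* Normal vectors only see the second order part [(B - A) G (B - A)] of the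
   difference of two matrices of the same rank. *)
Lemma normal_dot_le A B G N : normal_mx A N -> B *m G *m B = B ->
  `|frob_dot N (B - A)| <= frob N * frob G * frob (B - A) ^+ 2.
Proof.
move=> NA BGB.
have -> : frob_dot N (B - A) = frob_dot N ((B - A) *m G *m (B - A)).
  have -> : (B - A) *m G *m (B - A) =
      B - A *m (G *m B) - (B *m G) *m A + A *m (G *m A).
    by rewrite mulmxBr !mulmxBl BGB !mulmxA opprB addrA addrAC.
  rewrite !(frob_dotDr, frob_dotNr) !normal_dot_mull // normal_dot_mulr //.
  by rewrite (normal_dotxx NA) !subr0 addr0.
apply: le_trans (frob_CS _ _) _; rewrite -mulrA ler_wpM2l ?frob_ge0 //.
apply: le_trans (frob_mul _ _) _.
rewrite expr2 mulrA ler_wpM2r ?frob_ge0 //.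
by apply: le_trans (frob_mul _ _) _; rewrite mulrC.
Qed.

(** With G0 a reflexive inverse of A0 and M = 1 + G0 (B - A0), one has G0 A0 M = G0 B. As M is
    invertible for B near A0, G0 B has the rank of A0; this is the lower semicontinuity of the rank,
    and at equal rank M^-1 G0 is an inverse of B with bounded norm. *)
Lemma generalized_inverse_near A0 : exists2 d, 0 < d & exists g, 0 <= g /\
  forall B, frob (B - A0) < d -> (\rank A0 <= \rank B)%N /\
    (\rank B = \rank A0 -> exists2 G, frob G <= g & B *m G *m B = B).
Proof.
have [G0 [AGA GAG]] : exists G0 : 'M[R]_(m, l),
    A0 *m G0 *m A0 = A0 /\ G0 *m A0 *m G0 = G0.
  have [G1 AGA] : exists G1, A0 *m G1 *m A0 = A0.
    by exists (pinvmx A0); rewrite mulmxKpV // submx_refl.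
  exists (G1 *m A0 *m G1); split; first by rewrite !mulmxA !AGA.
  have cut (X : 'M[R]_(m, l)) : X *m A0 *m G1 *m A0 = X *m A0.
    by rewrite -[in RHS]AGA !mulmxA.
  by rewrite !mulmxA !cut.
pose c := frob G0; have c0 : 0 <= c by exact: frob_ge0.
have d0 : 0 < (2 * (c + 1))^-1 by rewrite invr_gt0; nra.
exists (2 * (c + 1))^-1 => //.
exists (2 * frob (1%:M : 'M[R]_m) * c); split.
  by rewrite !mulr_ge0 ?frob_ge0.
move=> B Bd; pose X := G0 *m (B - A0).
have X2 : frob X <= 2^-1.
  apply: le_trans (frob_mul _ _) _; rewrite -/c.
  have c1 : 0 < 2 * (c + 1) by lra.
  move: Bd; rewrite -div1r ltr_pdivlMr //.
  by have := frob_ge0 (B - A0); lra.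
have [Mu Mle] := unitmx_neumann X2; set M := 1%:M + X in Mu Mle.
have GAM : G0 *m A0 *m M = G0 *m B.
  by rewrite /M /X mulmxDr mulmx1 mulmxA GAG mulmxBr addrC subrK.
have rGB : \rank (G0 *m B) = \rank A0.
  rewrite -GAM mxrankMfree ?row_free_unit //; apply/eqP; rewrite eqn_leq.
  by rewrite mxrankM_maxr -{1}AGA -mulmxA mxrankM_maxr.
split=> [|rB]; first by rewrite -rGB mxrankM_maxr.
exists (invmx M *m G0).
  by apply: le_trans (frob_mul _ _) _; rewrite ler_wpM2r.
(* At equal rank B and G0 B have the same row space, so B = Y G0 B and the identity for B reduces to
   G0 A0 G0 = G0. *)
have /submxP[Y BY] : (B <= G0 *m B)%MS.
  by rewrite -(geq_leqif (mxrank_leqif_sup (submxMl G0 B))) rGB rB.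
have GBM : G0 *m B *m invmx M = G0 *m A0 by rewrite -GAM mulmxK.
rewrite {1}BY !mulmxA -(mulmxA Y G0 B) -(mulmxA Y) GBM -(mulmxA Y) GAG.
by rewrite -mulmxA -BY.
Qed.

(** The gap is automatic near A0. Without it, the r-th singular value would be at most |Y - A0|, so
    keeping r - 1 values would give a matrix near A0 of rank below r. Quasi-optimality, with factor
    l m, follows from [weyl_rank]: each discarded singular value is at most |Y - C|. *)
Lemma trunc_svd_near A0 r : (0 < r)%N -> \rank A0 = r ->
  exists2 d, 0 < d & forall Y, frob (Y - A0) < d ->
    [/\ \rank (trunc_svd r Y) = r, normal_mx (trunc_svd r Y) (Y - trunc_svd r Y)
    & forall C, \rank C = r ->
      frob (Y - trunc_svd r Y) <= (l * m)%:R * frob (Y - C)].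
Proof.
move=> r0 rA; have [d d0 [g [_ near_A0]]] := generalized_inverse_near A0.
pose c : R := (l * m)%:R; have c0 : 0 <= c by [].
exists (d / (c + 1)) => [|Y Yd]; first by rewrite divr_gt0 //; lra.
have gap U s V : is_svd Y U s V -> s r < s r.-1.
  move=> sY; rewrite ltNge; apply/negP => srr.
  have [UU VV sd _ _] := sY; have sge := is_svd_ge0 sY.
  have sr : s r <= frob (Y - A0) by apply: weyl_rank sY _; rewrite rA.
  pose B := svd_cut U s V (fun k => k < r.-1)%N.
  have YB : frob (Y - B) <= c * frob (Y - A0).
    rewrite (svd_cutC _ sY); apply: frob_svd_cut => //; first exact: frob_ge0.
    move=> k /=; rewrite -leqNgt => rk; rewrite ger0_norm //.
    exact: le_trans (sd _ _ rk) (le_trans srr sr).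
  have : frob (B - A0) < d.
    apply: le_lt_trans (frob_dist_triangle Y _ _) _; rewrite (frobBC B).
    by move: Yd; rewrite ltr_pdivlMr; lra.
  move=> /near_A0[+ _]; rewrite rA leqNgt => /negP; apply.
  rewrite -[X in (_ < X)%N](prednK r0) ltnS.
  exact: mxrank_svd_cut_le sY.
(* This witness excludes the default value of [xget]; the rest holds for whichever decomposition
   [xget] picks. *)
have [U0 [s0 [V0 sY0]]] := svd_exists Y.
rewrite /trunc_svd; case: xgetP => [B _|none]; last first.
  case: (none (svd_cut U0 s0 V0 (fun k => k < r)%N)).
  by exists U0, s0, V0; split=> //; exact: gap sY0.
move=> [U [s [V [sY srr]]]].
rewrite -/(svd_cut U s V (fun k => k < r)%N) => BE.
have [UU VV sd _ _] := sY; have sge := is_svd_ge0 sY.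
rewrite BE (svd_cutC _ sY); split.
- exact: mxrank_svd_cut_eq sY srr.
- exact: (svd_cut_normal _ sY).
- move=> C rC; apply: frob_svd_cut => //; first exact: frob_ge0.
  move=> k /=; rewrite -leqNgt => rk; rewrite ger0_norm //.
  by apply: weyl_rank sY _; rewrite rC.
Qed.

(** Symmetry makes A G and G A the orthogonal projections onto the column and row spaces of A, from
    which the normal component of a matrix is built. *)
Lemma moore_penrose A : exists G, [/\ A *m G *m A = A,
  (A *m G)^T = A *m G & (G *m A)^T = G *m A].
Proof.
have [U [s [V [UU VV _ s0 AE]]]] := svd_exists A.
(* The convention [0^-1 = 0] treats the zero singular values correctly. *)
pose t k := (s k)^-1; pose G := V *m rect_diag m l t *m U^T.
have sl k : (l <= k)%N -> s k = 0 by move=> lk; rewrite s0 // geq_min lk.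
have sm k : (m <= k)%N -> s k = 0 by move=> mk; rewrite s0 // geq_min mk orbT.
have tl k : (l <= k)%N -> t k = 0 by rewrite /t => /sl->; rewrite invr0.
have AG : A *m G = U *m rect_diag l l (fun k => s k * t k) *m U^T.
  by rewrite AE /G !mulmxA -(mulmxA _ V^T) VV mulmx1 -(mulmxA U) rect_diag_mul.
have GA : G *m A = V *m rect_diag m m (fun k => t k * s k) *m V^T.
  by rewrite AE /G !mulmxA -(mulmxA _ U^T) UU mulmx1 -(mulmxA V) rect_diag_mul.
exists G; split.
- rewrite AG {1}AE !mulmxA -(mulmxA _ U^T) UU mulmx1 -(mulmxA U) rect_diag_mul.
    rewrite [RHS]AE; congr (_ *m rect_diag _ _ _ *m _); apply/funext => k.
    rewrite /t; have [->|sk] := eqVneq (s k) 0; first by rewrite mulr0.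
    by rewrite divff ?mul1r.
  by move=> k /sl->; rewrite mul0r.
- by rewrite AG !trmx_mul trmxK rect_diag_tr mulmxA.
- by rewrite GA !trmx_mul trmxK rect_diag_tr mulmxA.
Qed.

End FixedRankGeometry.

(** * Tangent vectors and the orthogonal projection *)

Section TangentSpace.
Context {R : realType} {l m : nat}.
Implicit Types (A B C N L : 'M[R]_(l, m)).

Lemma is_derive_mx (M : R -> 'M[R]_(l, m)) (t : R) (dM : 'M[R]_(l, m)) :
  (forall i j, is_derive t 1 (fun x => M x i j) (dM i j)) <->
  is_derive t 1 M dM.
Proof.
split=> [dMij|[dM1 dM2] i j].
  have d1 : derivable M t 1 by apply/derivable_mxP => i j; case: (dMij i j).
  apply: DeriveDef => //; rewrite derive_mx //; apply/matrixP => i j.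
  by rewrite mxE; case: (dMij i j).
have /derivable_mxP dMij := dM1.
by apply: DeriveDef => //; rewrite -dM2 derive_mx // mxE.
Qed.

(** The curve (1 + t X) A (1 + t Y) keeps the rank of A as long as both outer factors are
    invertible. *)
Lemma tangent_mulmx (r : nat) A (X : 'M[R]_l) (Y : 'M[R]_m) : \rank A = r ->
  tangent r A (X *m A + A *m Y).
Proof.
move=> rA; pose g (t : R) := (1%:M + t *: X) *m A *m (1%:M + t *: Y).
have gE t : g t = A + t *: (X *m A + A *m Y) + t ^+ 2 *: (X *m A *m Y).
  rewrite /g mulmxDl mul1mx mulmxDr mulmx1 mulmxDl -!scalemxAl -!scalemxAr.
  by rewrite scalerA -expr2 scalerDr !addrA.
have dg (t : R) : is_derive t 1 g (X *m A + A *m Y + (2 * t) *: (X *m A *m Y)).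
  apply/is_derive_mx => i j.
  rewrite (_ : (fun x => g x i j) = (fun x => A i j +
    x * (X *m A + A *m Y) i j + x ^+ 2 * (X *m A *m Y) i j)); last first.
    by apply/funext => x; rewrite gE !mxE.
  apply: is_derive_eq; rewrite !mxE /GRing.scale /=; ring.
have unit_near n (Z : 'M[R]_n) :
    \forall t \near (0 : R), 1%:M + t *: Z \in unitmx.
  have Z0 := frob_ge0 Z.
  have e0 : 0 < (2 * (frob Z + 1))^-1 by rewrite invr_gt0; lra.
  near=> t; apply: (unitmx_neumann _).1; rewrite frobZ.
  have : `|t| < (2 * (frob Z + 1))^-1.
    by near: t; exact: (@nbhs0_lt R R^o _ e0).
  rewrite -div1r ltr_pdivlMr; last lra.
  by have := normr_ge0 t; nra.
exists g; split.
- by rewrite gE !scale0r expr0n /= scale0r !addr0.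
- near=> t; rewrite /fixed_rank /= /g mxrankMfree; last first.
    by rewrite row_free_unit; near: t; exact: unit_near.
  rewrite (eqmxMfull _ _) // row_full_unit; near: t; exact: unit_near.
- by near=> t; case: (dg t).
- by have := dg 0; rewrite mulr0 scale0r addr0.
Unshelve. all: by end_near. Qed.

(** The curve keeps the rank r, so [normal_dot_le] bounds <N, g h - A> by a multiple of h^2; the
    difference quotients are orthogonal to N in the limit. *)
Lemma tangent_normal (r : nat) A N Z : \rank A = r ->
  tangent r A Z -> normal_mx A N -> frob_dot N Z = 0.
Proof.
move=> rA [g [g0 g_rank _ [dg1 dg2]]] NA.
have [d d0 [k [k0 nearA]]] := generalized_inverse_near A.
pose q (h : R) := h^-1 *: (g h - A).
have qZ : q h @[h --> 0^'] --> Z.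
  rewrite -dg2; move: dg1; rewrite /derivable /derive /=.
  under eq_fun do rewrite g0 /= /GRing.scale /= mulr1 addr0.
  exact.
have N0 := frob_ge0 N; have Z0 := frob_ge0 Z.
apply/eqP; rewrite -normr_le0; apply/ler_addgt0Pl => e e0; rewrite addr0.
(* For |h| and |q h - Z| below e / c, the two error terms add up to at most e (c - 1) / c; the final
   1 keeps c positive. *)
pose c := frob N * (1 + k * (frob Z + 1) ^+ 2) + 1.
have k1 : 0 <= k * (frob Z + 1) ^+ 2 by rewrite mulr_ge0 ?sqr_ge0.
have c0 : 0 < c by rewrite /c; nra.
have ec0 : 0 < e / c by rewrite divr_gt0.
have dz0 : 0 < d / (frob Z + 1) by rewrite divr_gt0 //; lra.
have /filter_ex[h [[h0 hec hd] [q1 qec hr]]] : \forall h \near (0 : R)^',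
    [/\ h != 0, `|h| < e / c & `|h| < d / (frob Z + 1)] /\
    [/\ frob (q h - Z) < 1, frob (q h - Z) < e / c & \rank (g h) = r].
  have /cvg_frobP qZ' := qZ.
  near=> h; split; split.
  - by near: h; exact: nbhs_dnbhs_neq.
  - by near: h; exact: dnbhs0_lt.
  - by near: h; exact: dnbhs0_lt.
  - by near: h; exact: qZ'.
  - by near: h; exact: qZ'.
  - by near: h; exact: nbhs_dnbhs.
have hgt : 0 < `|h| by rewrite normr_gt0.
have qle : frob (q h) <= frob Z + 1.
  by have := frobD (q h - Z) Z; rewrite subrK; lra.
have gq : g h - A = h *: q h by rewrite /q scalerA divff // scale1r.
have gqn : frob (g h - A) <= `|h| * (frob Z + 1).
  by rewrite gq frobZ ler_wpM2l.
have gd : frob (g h - A) < d.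
  apply: le_lt_trans gqn _; rewrite -ltr_pdivlMr //; lra.
have [_ [|G Gk GBG]] := nearA _ gd; first by rewrite hr rA.
have Nq : `|frob_dot N (q h)| <= frob N * k * (`|h| * (frob Z + 1) ^+ 2).
  rewrite -(ler_pM2l hgt) -normrM -frob_dotZr -gq.
  apply: le_trans (normal_dot_le NA GBG) _.
  have -> : `|h| * (frob N * k * (`|h| * (frob Z + 1) ^+ 2)) =
    frob N * k * (`|h| * (frob Z + 1)) ^+ 2 by ring.
  apply: ler_pM; rewrite ?mulr_ge0 ?frob_ge0 ?sqr_ge0 //.
    by rewrite ler_wpM2l.
  by rewrite ler_pXn2r ?nnegrE ?frob_ge0 // mulr_ge0 //; lra.
have NZ : `|frob_dot N Z| <= frob N * frob (q h - Z) + `|frob_dot N (q h)|.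
  rewrite {1}(_ : Z = - (q h - Z) + q h); last by rewrite opprB subrK.
  rewrite frob_dotDr frob_dotNr; apply: le_trans (ler_normD _ _) _.
  by rewrite normrN lerD2r frob_CS.
have ecc : e / c * c = e by rewrite divfK // gt_eqF.
have p1 : frob N * frob (q h - Z) <= frob N * (e / c).
  by rewrite ler_wpM2l // ltW.
have p2 : frob N * k * (`|h| * (frob Z + 1) ^+ 2) <=
    frob N * k * (e / c * (frob Z + 1) ^+ 2).
  by rewrite ler_wpM2l ?mulr_ge0 // ler_wpM2r ?sqr_ge0 // ltW.
apply: le_trans NZ _; apply: le_trans (lerD p1 (le_trans Nq p2)) _.
have cE : c = frob N * (1 + k * (frob Z + 1) ^+ 2) + 1 by [].
move: (e / c) ecc (ltW ec0) => x; rewrite cE => <- x0; nra.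
Unshelve. all: by end_near. Qed.

(** The explicit component N0 shows that a projection exists, which rules out the default value. For
    the P returned by [xget], the normality of L - P is recovered from its orthogonality to all
    tangent vectors, and the norm bound is Pythagoras. *)
Lemma orth_proj_tangent A L : exists2 N, normal_mx A N &
  orth_proj (tangent (\rank A) A) L = L - N /\ frob N <= frob L.
Proof.
pose r := \rank A; have rA : \rank A = r by [].
have [G [AGA AG GA]] := moore_penrose A.
pose N0 := (1%:M - A *m G) *m L *m (1%:M - G *m A).
have N0n : normal_mx A N0.
  have AN : A^T *m (1%:M - A *m G) = 0.
    by rewrite mulmxBr mulmx1 -[A *m G]AG -trmx_mul AGA subrr.
  have NA : (1%:M - G *m A) *m A^T = 0.
    by rewrite mulmxBl mul1mx -[G *m A]GA -trmx_mul mulmxA AGA subrr.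
  split; first by rewrite /N0 !mulmxA AN !mul0mx.
  by rewrite /N0 -(mulmxA _ (1%:M - G *m A)) NA mulmx0.
have tE : L - N0 = (L *m G - A *m G *m L *m G) *m A + A *m (G *m L).
  rewrite /N0 mulmxBr mulmx1 !mulmxBl !mul1mx !mulmxA.
  move: (A *m G *m L *m G *m A) (A *m G *m L) (L *m G *m A) => a b c.
  by apply/matrixP => i j; rewrite !mxE; ring.
rewrite /orth_proj; case: xgetP => [P _ [tP oP]|none]; last first.
  exfalso; apply: (none (L - N0)); split.
    by rewrite tE; exact: tangent_mulmx.
  move=> Y tY; rewrite opprB addrC subrK; exact: tangent_normal tY N0n.
(* Orthogonality to the tangent vectors A A^T (L - P) and (L - P) A^T A says that A^T (L - P) and (L
   - P) A^T have norm 0. *)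
have NP : normal_mx A (L - P).
  split.
    apply: frob_eq0; apply/eqP; rewrite -sqrf_eq0 sqr_frob frob_dot_mull trmxK.
    apply/eqP; apply: oP; have := tangent_mulmx 0 (A^T *m (L - P)) rA.
    by rewrite mul0mx add0r.
  apply: frob_eq0; apply/eqP; rewrite -sqrf_eq0 sqr_frob frob_dot_mulr trmxK.
  apply/eqP; apply: oP; have := tangent_mulmx ((L - P) *m A^T) 0 rA.
  by rewrite mulmx0 addr0.
exists (L - P) => //; split; first by rewrite opprB addrC subrK.
rewrite -(@ler_pXn2r _ 2) ?nnegrE ?frob_ge0 // !sqr_frob.
have -> : frob_dot L L = frob_dot (L - P) (L - P) + frob_dot P P +
    2 * frob_dot (L - P) P.
  by rewrite !(frob_dotBl, frob_dotBr) (frob_dotC P L); ring.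
by rewrite (oP _ tP) mulr0 addr0 lerDl frob_dotxx_ge0.
Qed.

End TangentSpace.

(** * Compactness along the path *)

Section UniformityOnPaths.
Context {R : realType} {l m : nat} (T : R).
Implicit Types (X Y : R -> 'M[R]_(l, m)).

Lemma segment_uniform (P : R -> R -> Prop) :
  (forall t0, 0 <= t0 <= T ->
    \forall t \near t0 & d \near 0^'+, 0 <= t <= T -> P d t) ->
  exists2 d, 0 < d & forall t, 0 <= t <= T -> P d t.
Proof.
move=> locP; have := @segment_compact R 0 T.
move=> /compact_near_coveringP/near_covering_withinP.
move=> /(_ R 0^'+ P _) cov.
have {cov} nearP : \forall d \near 0^'+, `[0, T]%classic `<=` P d.
  apply: cov => t0; rewrite /= in_itv /= => /locP.
  by apply: filterS => -[t d] /=; rewrite in_itv.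
have /filter_ex[d [d0 Pd]] : \forall d \near 0^'+,
    0 < d /\ `[0, T]%classic `<=` P d.
  by near=> d; split; near: d => //; exact: nbhs_right_gt.
by exists d => // t tT; apply: Pd; rewrite /= in_itv.
Unshelve. all: by end_near. Qed.

Definition continuous_path Y := forall t0, 0 <= t0 <= T -> forall e, 0 < e ->
  \forall t \near t0, 0 <= t <= T -> frob (Y t - Y t0) < e.

Lemma within_continuous_path Y :
  {within `[0, T], continuous Y} -> continuous_path Y.
Proof.
move=> /subspace_continuousP cY t0 t0T e e0.
have /cY /cvg_frobP /(_ e e0) : `[0, T]%classic t0 by rewrite /= in_itv.
by apply: filterS => t.
Qed.

(** Heine-Cantor: half the radius of continuity at t0 is left for the distance from t to s. *)
Lemma path_uniform Y : continuous_path Y -> forall e, 0 < e ->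
  exists2 d, 0 < d & forall t, 0 <= t <= T -> forall s, 0 <= s <= T ->
    `|s - t| <= d -> frob (Y s - Y t) <= e.
Proof.
move=> cY e e0; apply: segment_uniform => t0 t0T.
have e2 : 0 < e / 2 by rewrite divr_gt0.
have [a a0 near_t0] : exists2 a : R, 0 < a & forall t, `|t0 - t| < a ->
    0 <= t <= T -> frob (Y t - Y t0) < e / 2.
  by have /nbhs_ballP[a a0 near_t0] := cY t0 t0T _ e2; exists a.
have a2 : 0 < a / 2 by rewrite divr_gt0.
near=> t d => /= tT s sT st.
have d2 : d < a / 2 by near: d; exact: nbhs_right_lt.
have tt0 : `|t0 - t| < a / 2 by near: t; exact: cvgr_dist_lt.
have Yt : frob (Y t - Y t0) < e / 2.
  by apply: near_t0 => //; lra.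
have Ys : frob (Y s - Y t0) < e / 2.
  apply: near_t0 => //.
  by have := ler_distD t t0 s; rewrite (distrC t s); lra.
by have := frob_dist_triangle (Y t0) (Y s) (Y t); rewrite (frobBC (Y t0)); lra.
Unshelve. all: by end_near. Qed.

(** Seeking the bound as an inverse [d^-1] turns a large bound into a small d, the form that
    [segment_uniform] handles. *)
Lemma path_bounded Y : continuous_path Y ->
  exists2 q, 0 < q & forall t, 0 <= t <= T -> frob (Y t) <= q.
Proof.
move=> cY; have [d d0 Yd] : exists2 d, 0 < d &
    forall t, 0 <= t <= T -> frob (Y t) <= d^-1.
  apply: segment_uniform => t0 t0T.
  have Y0 := frob_ge0 (Y t0).
  have c0 : 0 < (frob (Y t0) + 1)^-1 by rewrite invr_gt0; lra.
  near=> t d => /= tT.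
  have Yt : frob (Y t - Y t0) < 1 by move: tT; near: t; exact: cY.
  have dd : d < (frob (Y t0) + 1)^-1 by near: d; exact: nbhs_right_lt.
  have d0 : 0 < d by near: d; exact: nbhs_right_gt.
  have : frob (Y t0) + 1 <= d^-1.
    by rewrite -[leLHS]invrK lef_pV2 ?posrE // ltW.
  by have := frobD (Y t - Y t0) (Y t0); rewrite subrK; lra.
by exists d^-1; rewrite ?invr_gt0.
Unshelve. all: by end_near. Qed.

(* The same [d] serves as radius and as inverse of a bound, so that one
   compactness argument provides both. *)
Lemma fixed_rank_tube (r : nat) X : (0 < r)%N -> continuous_path X ->
  (forall t, 0 <= t <= T -> \rank (X t) = r) ->
  exists2 d, 0 < d & forall t, 0 <= t <= T -> forall B, frob (B - X t) <= d ->
    [/\ \rank B = r -> exists2 G, frob G <= d^-1 & B *m G *m B = B,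
      \rank (trunc_svd r B) = r,
      normal_mx (trunc_svd r B) (B - trunc_svd r B)
    & forall C, \rank C = r ->
      frob (B - trunc_svd r B) <= (l * m)%:R * frob (B - C)].
Proof.
move=> r0 cX rX; apply: segment_uniform => t0 t0T.
have [d1 d10 [g [g0 near1]]] := generalized_inverse_near (X t0).
have [d2 d20 near2] := trunc_svd_near r0 (rX _ t0T).
have a0 : 0 < Num.min d1 d2 / 2 by rewrite divr_gt0 // lt_min d10.
have c0 : 0 < (g + 1)^-1 by rewrite invr_gt0; lra.
near=> t d => /= tT B Bt.
have Xt : frob (X t - X t0) < Num.min d1 d2 / 2.
  by move: tT; near: t; exact: cX.
have da : d < Num.min d1 d2 / 2 by near: d; exact: nbhs_right_lt.
have dg : d < (g + 1)^-1 by near: d; exact: nbhs_right_lt.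
have d0 : 0 < d by near: d; exact: nbhs_right_gt.
have : frob (B - X t0) < Num.min d1 d2.
  by have := frob_dist_triangle (X t) B (X t0); lra.
rewrite lt_min => /andP[/near1[_ BG] /near2[? ? ?]]; split=> //.
rewrite -(rX _ t0T) => /BG[G Gg BGB]; exists G => //; apply: le_trans Gg _.
have : g + 1 <= d^-1 by rewrite -[leLHS]invrK lef_pV2 ?posrE // ltW.
lra.
Unshelve. all: by end_near. Qed.

Lemma consistent_continuous (L : R -> 'M[R]_(l, m) -> 'M[R]_(l, m)) Lbar :
  consistent T L Lbar -> forall t0, 0 <= t0 <= T -> forall A0 e, 0 < e ->
  exists2 d, 0 < d & forall t A h, `|t - t0| < d -> frob (A - A0) < d ->
    0 <= h < d -> 0 <= t -> t + h <= T ->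
    frob (Lbar t A h - L t0 A0) < e.
Proof.
move=> cons t0 t0T A0 e e0; have [LE /cvg_frobP cL] := cons t0 t0T A0.
have := cL e e0; rewrite LE near_withinE.
move=> -[[V W] /= [[[V1 V2] /= [V1t V2A] VV] W0] VW].
have /nbhs_ballP[d1 /= d10 dV1] := V1t.
have /nbhs_frobP[d2 d20 dV2] := V2A.
have /nbhs_ballP[d3 /= d30 dW] := W0.
exists (Num.min d1 (Num.min d2 d3)); first by rewrite !lt_min d10 d20.
move=> t A h; rewrite !lt_min => /and3P[t1 _ _] /and3P[_ A2 _].
move=> /andP[h0 /and3P[_ _ h3]] t_ge thT.
apply: (VW (t, A, h)) => //=; split.
  by apply: VV; split; [apply: dV1; rewrite /= /ball /= distrC|exact: dV2].
by apply: dW; rewrite /= /ball /= sub0r normrN ger0_norm.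
Qed.

(** The Lipschitz assumption says nothing about time; continuity in t comes from consistency at h =
    0, where [Lbar] equals L. *)
Lemma consistent_path (L : R -> 'M[R]_(l, m) -> 'M[R]_(l, m)) Lbar X :
  consistent T L Lbar -> continuous_path X ->
  continuous_path (fun t => L t (X t)).
Proof.
move=> cons cX t0 t0T e e0.
have [d d0 near_t0] := consistent_continuous cons t0T (X t0) e0.
near=> t => tT; have [<- _] := cons t tT (X t); have /andP[t_ge t_le] := tT.
apply: near_t0 => //; rewrite ?lexx ?addr0 //.
by move: tT; near: t; exact: cX.
Unshelve. all: by end_near. Qed.

(** Near (t0, A0), both [Lbar t A h] and [L t A = Lbar t A 0] are close to [L t0 A0]; compactness of
    [0, T] times the ball makes the step size uniform. *)
Lemma consistent_uniform (L : R -> 'M[R]_(l, m) -> 'M[R]_(l, m)) Lbar q :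
  consistent T L Lbar -> forall e, 0 < e ->
  exists2 d, 0 < d & forall t A h, frob A <= q -> 0 <= h <= d ->
    0 <= t -> t + h <= T -> frob (Lbar t A h - L t A) <= e.
Proof.
move=> cons e e0.
have := compact_setX (@segment_compact R 0 T) (@compact_frob_ball R l m q).
move=> /compact_near_coveringP/near_covering_withinP.
pose P (d : R) (p : R * 'M[R]_(l, m)) := forall h,
  0 <= h <= d -> p.1 + h <= T -> frob (Lbar p.1 p.2 h - L p.1 p.2) <= e.
move=> /(_ R 0^'+ P _) cov.
have {cov} /filter_ex[d [d0 Pd]] : \forall d \near 0^'+, 0 < d /\
    `[0, T]%classic `*` [set A : 'M[R]_(l, m) | frob A <= q] `<=` P d.
  near=> d; split; near: d; first exact: nbhs_right_gt.
  apply: cov => -[t0 A0] [/= t0T _]; rewrite in_itv /= in t0T.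
  have e2 : 0 < e / 2 by rewrite divr_gt0.
  have [c c0 near0] := consistent_continuous cons t0T A0 e2.
  have near_tA : \forall p \near (t0, A0),
      `|p.1 - t0| < c /\ frob (p.2 - A0) < c.
    exists ([set t | `|t - t0| < c], [set A | frob (A - A0) < c]) => /=.
      split; last by apply/nbhs_frobP; exists c.
      apply/nbhs_ballP; exists c => // t; by rewrite /ball /= distrC.
    by case=> t A /= [].
  near=> p d => /= -[+ _] h /andP[h0 hd] phT.
  rewrite /= in_itv /= => /andP[p0 pT].
  have [pt pA] : `|p.1 - t0| < c /\ frob (p.2 - A0) < c by near: p.
  have dc : d < c by near: d; exact: nbhs_right_lt.
  have [|<- _] := cons p.1 _ p.2; first by rewrite p0.
  have := near0 _ _ h pt pA; rewrite h0 (le_lt_trans hd) // => /(_ isT p0 phT).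
  have := near0 _ _ 0 pt pA; rewrite lexx c0 addr0 => /(_ isT p0 pT).
  by have := frob_dist_triangle (L t0 A0) (Lbar p.1 p.2 h) (Lbar p.1 p.2 0);
    rewrite (frobBC (L t0 A0)); lra.
exists d => // t A h Aq hd t0 thT; apply: (Pd (t, A)) => //; split=> //=.
by rewrite in_itv /= t0; case/andP: hd; lra.
Unshelve. all: by end_near. Qed.

End UniformityOnPaths.

(** * Error estimates *)

Section OneStep.
Context {R : realType} {l m : nat}.
Implicit Types (A B C N G : 'M[R]_(l, m)) (X : R -> 'M[R]_(l, m)).

Lemma is_derive_frob_dotxx (D : R -> 'M[R]_(l, m)) (t : R) (dD : 'M[R]_(l, m)) :
  is_derive t 1 D dD ->
  is_derive t 1 (fun s => frob_dot (D s) (D s)) (2 * frob_dot (D t) dD).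
Proof.
move=> /is_derive_mx dDij.
rewrite (_ : (fun s => _) =
    \sum_(i < l) \sum_(j < m) (fun s => D s i j * D s i j)); last first.
  apply/funext => s; rewrite frob_dotE fct_sumE; apply: eq_bigr => i _.
  by rewrite fct_sumE.
rewrite (_ : 2 * _ = \sum_(i < l) \sum_(j < m) (2 * (D t i j * dD i j))).
  apply: is_derive_sum => i; apply: is_derive_sum => j.
  by apply: is_derive_eq; rewrite /GRing.scale /=; ring.
rewrite frob_dotE mulr_sumr; apply: eq_bigr => i _.
by rewrite mulr_sumr.
Qed.

(** Passing to the scalar |D|^2 gives a mean value equality, which asks for derivatives in the open
    interval only, as in [solves_on]. *)
Lemma frob_mean_value (D dD : R -> 'M[R]_(l, m)) (a b : R) : a < b ->
  {within `[a, b], continuous D} ->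
  (forall t, a < t < b -> is_derive t 1 D (dD t)) ->
  exists2 t, a < t < b &
    frob (D b) ^+ 2 = frob (D a) ^+ 2 + (b - a) * (2 * frob_dot (D t) (dD t)).
Proof.
move=> ab cD dDt.
have [t||t] := @MVT R (fun t => frob_dot (D t) (D t))
    (fun t => 2 * frob_dot (D t) (dD t)) a b ab.
- by rewrite in_itv => /dDt; exact: is_derive_frob_dotxx.
- apply/subspace_continuousP => t; move/subspace_continuousP: cD => cD /cD Dt.
  exact: (cvg_frob_dot Dt Dt).
- rewrite in_itv /= => tab E; exists t => //.
  by rewrite !sqr_frob mulrC -E addrC subrK.
Qed.

Lemma drift_bound X (dX : R -> 'M[R]_(l, m)) (t0 h : R) A G e : 0 < h ->
  {within `[t0, t0 + h], continuous X} ->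
  (forall t, t0 < t < t0 + h -> is_derive t 1 X (dX t)) ->
  (forall t, t0 < t < t0 + h ->
    frob_dot (A + (t - t0) *: G - X t) (G - dX t) <= e) ->
  frob (A + h *: G - X (t0 + h)) ^+ 2 <= frob (A - X t0) ^+ 2 + h * (2 * e).
Proof.
move=> h0 cX dXt De; pose D (t : R) := A + (t - t0) *: G - X t.
have tt : t0 < t0 + h by rewrite ltrDl.
have cD : {within `[t0, t0 + h], continuous D}.
  apply/subspace_continuousP => t; move/subspace_continuousP: cX => cX /cX Xt.
  apply: cvgB => //; apply: cvgD; first exact: cvg_cst.
  apply: cvgZr_tmp; apply: cvgB; last exact: cvg_cst.
  exact: cvg_within.
have dD t : t0 < t < t0 + h -> is_derive t 1 D (G - dX t).
  move=> /dXt /is_derive_mx dXij; apply/is_derive_mx => i j.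
  rewrite (_ : (fun s => D s i j) =
    (fun s => A i j + (s - t0) * G i j - X s i j)).
    by apply: is_derive_eq; rewrite !mxE /GRing.scale /=; ring.
  by apply/funext => s; rewrite !mxE.
have [t tab] := frob_mean_value tt cD dD.
rewrite /D subrr scale0r addr0 [t0 + h]addrC addrK => ->.
by rewrite lerD2l ler_wpM2l ?(ltW h0) // ler_wpM2l // De.
Qed.

(** Here |B - C|^2 = <B - C, Y - C> + <Y - B, C - B>, where the last term is at most k |B - C|^2 by
    normality. With k = O(h), truncation is nonexpansive up to a factor 1 + O(h). *)
Lemma proj_step Y B C (W : 'M[R]_(m, l)) k :
  normal_mx B (Y - B) -> C *m W *m C = C -> frob (Y - B) * frob W <= k ->
  frob (B - C) * (1 - k) <= frob (Y - C).
Proof.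
move=> NB CWC Nk; have [->|BC0] := eqVneq (frob (B - C)) 0.
  by rewrite mul0r frob_ge0.
have BC : 0 < frob (B - C) by rewrite lt_def BC0 frob_ge0.
rewrite -(ler_pM2l BC) mulrA -expr2 mulrBr mulr1 lerBlDr.
rewrite {1}(_ : frob (B - C) ^+ 2 =
  frob_dot (B - C) (Y - C) + frob_dot (Y - B) (C - B)); last first.
  rewrite sqr_frob !(frob_dotBl, frob_dotBr) (frob_dotC Y B) (frob_dotC Y C).
  by rewrite (frob_dotC C B); ring.
rewrite lerD ?frob_dot_le //; apply: le_trans (ler_norm _) _.
apply: le_trans (normal_dot_le NB CWC) _.
by rewrite (frobBC C) mulrC ler_wpM2l ?sqr_ge0.
Qed.

(** The inner product splits into <A + tau G - X, G - L> + <N, A - X> + tau <G, N>: consistency and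
    Lipschitz error, quadratic normal term, and drift within the step. *)
Lemma drift_dot_le A (X L : 'M[R]_(l, m)) N G (W : 'M[R]_(m, l))
    (tau a b q g e : R) :
  normal_mx X N -> A *m W *m A = A -> frob N <= q -> frob W <= g ->
  0 <= tau -> tau * frob G <= e -> frob (G - L) <= b ->
  frob (A - X) <= a -> frob (A + tau *: G - X) <= a ->
  frob_dot (A + tau *: G - X) (G - (L - N)) <= a * b + q * g * a ^+ 2 + e * q.
Proof.
move=> NX AWA Nq Wg tau0 Ge GL AX AGX.
have W0 := frob_ge0 W; have N0 := frob_ge0 N; have G0 := frob_ge0 G.
have -> : frob_dot (A + tau *: G - X) (G - (L - N)) =
    frob_dot (A + tau *: G - X) (G - L) + frob_dot N (A - X) +
    tau * frob_dot G N.
  rewrite !(frob_dotBl, frob_dotBr, frob_dotDl, frob_dotZl).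
  by rewrite (frob_dotC N A) (frob_dotC N X); ring.
rewrite !lerD //.
- by apply: le_trans (frob_dot_le _ _) _; rewrite ler_pM ?frob_ge0.
- apply: le_trans (ler_norm _) _; apply: le_trans (normal_dot_le NX AWA) _.
  have NW : frob N * frob W <= q * g by apply: ler_pM.
  have AX2 : frob (A - X) ^+ 2 <= a ^+ 2.
    by rewrite ler_pXn2r ?nnegrE ?frob_ge0 // (le_trans (frob_ge0 _) AX).
  by apply: ler_pM NW AX2; [exact: mulr_ge0|exact: sqr_ge0].
- apply: (@le_trans _ _ (tau * frob G * frob N)).
    by rewrite -mulrA ler_wpM2l // frob_dot_le.
  by rewrite ler_pM ?mulr_ge0.
Qed.

End OneStep.

(** * One-step recursion and discrete Gronwall argument *)

Section Convergence.
Context {R : realType}.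

(* The term [eta * Q] is not quadratic in the error, whence the recursion on
   [e ^+ 2 + eta] rather than on [e]. *)
Lemma error_growth (K Q g c e eta h th x y : R) :
  0 <= K -> 0 <= Q -> 0 <= g -> 0 <= c -> 0 <= e -> 0 <= eta <= 1 -> 0 <= h ->
  0 <= th <= h * c -> th <= 4^-1 -> 0 <= x -> x * (1 - th) <= y ->
  y ^+ 2 <= e ^+ 2 + h * (2 * ((e + 2 * eta) * (2 * eta + K * e) +
    Q * g * (e + 2 * eta) ^+ 2 + eta * Q)) ->
  x ^+ 2 + eta <=
  (1 + h * (4 * c + 2 * (16 + 2 * K ^+ 2 + 16 * (Q * g) + 2 * Q))) *
  (e ^+ 2 + eta).
Proof.
move=> K0 Q0 g0 c0 e0 /andP[eta0 eta1] h0 /andP[th0 thc] th1 x0 xy yle.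
(* The first two terms come from [s3], the others from twice [s4] and [s5]. In the final constant, 4
   c and the factor 2 on C1 pay for the multiplication by 1 + 4 th. *)
set C1 := 16 + 2 * K ^+ 2 + 16 * (Q * g) + 2 * Q.
pose S := e ^+ 2 + eta.
have K2 : 0 <= K ^+ 2 by exact: sqr_ge0.
have e2 : 0 <= e ^+ 2 by exact: sqr_ge0.
have Qg : 0 <= Q * g by exact: mulr_ge0.
have S0 : 0 <= S by rewrite addr_ge0.
(* Since S is only linear in eta, this is what lets it absorb squares of eta. *)
have eta2 : eta ^+ 2 <= eta by rewrite expr2; nra.
have s1 : (e + 2 * eta) ^+ 2 <= 8 * S.
  have := sqr_ge0 (e - 2 * eta); rewrite /S => ?; nra.
have s2 : (2 * eta + K * e) ^+ 2 <= (8 + 2 * K ^+ 2) * S.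
  have := sqr_ge0 (2 * eta - K * e).
  have : 0 <= K ^+ 2 * eta by exact: mulr_ge0.
  rewrite /S => ? ?; nra.
have s3 : 2 * ((e + 2 * eta) * (2 * eta + K * e)) <= (16 + 2 * K ^+ 2) * S.
  have := sqr_ge0 ((e + 2 * eta) - (2 * eta + K * e)) => ?; nra.
have s4 : Q * g * (e + 2 * eta) ^+ 2 <= Q * g * (8 * S) by rewrite ler_wpM2l.
have s5 : eta * Q <= Q * S.
  by rewrite mulrC ler_wpM2l // /S lerDr.
have hC : y ^+ 2 <= e ^+ 2 + h * (C1 * S).
  apply: le_trans yle _; rewrite lerD2l ler_wpM2l // /C1; lra.
have C10 : 0 <= C1 by rewrite /C1; lra.
have hCS : 0 <= h * (C1 * S) by rewrite !mulr_ge0.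
(* Replaces a division by (1 - th)^2; it relies on th <= 1/4. *)
have th2 : 1 <= (1 - th) ^+ 2 * (1 + 4 * th) by nra.
have xy2 : (x * (1 - th)) ^+ 2 <= y ^+ 2.
  by rewrite ler_pXn2r ?nnegrE //; [nra|apply: le_trans xy; nra].
have xle : x ^+ 2 <= (e ^+ 2 + h * (C1 * S)) * (1 + 4 * th).
  apply: (@le_trans _ _ ((x * (1 - th)) ^+ 2 * (1 + 4 * th))).
    by rewrite exprMn -mulrA ler_peMr ?sqr_ge0.
  by rewrite ler_wpM2r //; [lra|apply: le_trans hC].
have eS : e ^+ 2 * th <= S * (h * c).
  by rewrite ler_pM // /S lerDl.
have hth : h * (C1 * S) * (4 * th) <= h * (C1 * S).
  by rewrite ler_piMr //; lra.
have SE : S = e ^+ 2 + eta by [].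
have xE : (e ^+ 2 + h * (C1 * S)) * (1 + 4 * th) = e ^+ 2 + h * (C1 * S) +
  4 * (e ^+ 2 * th) + h * (C1 * S) * (4 * th) by ring.
move: C1 S SE {S0 C10 s1 s2 s3 s4 s5 hC} xle xE eS hth hCS => C1 S SE *.
rewrite -SE; lra.
Qed.

Context {l m r : nat} {T : R}.
Context {L : R -> 'M[R]_(l, m) -> 'M[R]_(l, m)}.
Context {Lbar : R -> 'M[R]_(l, m) -> R -> 'M[R]_(l, m)}.
Context {X : R -> 'M[R]_(l, m)}.
Context (r0 : (0 < r)%N).
Context (consL : consistent T L Lbar).
Context (rankX : forall t : R, 0 <= t <= T -> fixed_rank r (X t)).
Context (solX : solves_on T (fun t A => orth_proj (tangent r A) (L t A)) X).
Context (lipL : exists K : R, lipschitz_frob T K L).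

(** The order of quantifiers matters: the tube radius d and the growth rate Lam are fixed before
    eta, so the Gronwall factor stays bounded as eta goes to 0; only the step threshold depends on
    eta. *)
Lemma scheme_step : exists d Lam : R, [/\ 0 < d, 0 <= Lam &
  forall eta, 0 < eta <= 1 -> exists2 h0, 0 < h0 &
  forall t h A, 0 < h <= h0 -> 0 <= t -> t + h <= T -> \rank A = r ->
  frob (A - X t) + 2 * eta <= d ->
  let B := trunc_svd r (A + h *: Lbar t A h) in
  \rank B = r /\ frob (B - X (t + h)) ^+ 2 + eta <=
    (1 + h * Lam) * (frob (A - X t) ^+ 2 + eta)].
Proof.
have [K0 lipK0] := lipL; have [contX dX] := solX.
have [K Kge lipK] : exists2 K : R, 0 <= K & lipschitz_frob T K L.
  exists `|K0| => // t tT A B; apply: le_trans (lipK0 t tT A B) _.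
  by rewrite ler_wpM2r ?frob_ge0 ?ler_norm.
have pathX := within_continuous_path contX.
have pathL := consistent_path consL pathX.
have [qX qX0 Xq] := path_bounded pathX.
have [Q Q0 LQ] := path_bounded pathL.
have [d d0 tube] := fixed_rank_tube r0 pathX rankX.
pose g := d^-1; have g0 : 0 < g by rewrite invr_gt0.
(* Bounds |Lbar t A h| in the tube: consistency error at most 1, Lipschitz deviation from X, and L
   along X. *)
pose Q1 := 1 + K * d + Q.
have Q10 : 0 < Q1 by rewrite /Q1; nra.
pose c : R := (l * m)%:R; have c0 : 0 <= c by [].
pose C2 := c * Q1 * g; have C20 : 0 <= C2 by rewrite !mulr_ge0 // ltW.
exists d, (4 * C2 + 2 * (16 + 2 * K ^+ 2 + 16 * (Q * g) + 2 * Q)); split=> //.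
  have := sqr_ge0 K; have : 0 < Q * g by exact: mulr_gt0.
  by lra.
move=> eta /andP[eta0 eta1].
have [h1 h10 unifLbar] := consistent_uniform (qX + d) consL eta0.
have [h2 h20 unifX] := path_uniform pathX eta0.
have [h3 h30 unifL] := path_uniform pathL eta0.
have h40 : 0 < eta / Q1 by rewrite divr_gt0.
have h50 : 0 < (4 * (C2 + 1))^-1 by rewrite invr_gt0; lra.
(* In order: consistency error, variation of X and of L along X over a step, increment h |Lbar| at
   most eta, and th at most 1/4. *)
exists (Num.min h1 (Num.min h2 (Num.min h3
  (Num.min (eta / Q1) (4 * (C2 + 1))^-1)))).
  by rewrite !lt_min h10 h20 h30 h40.
move=> t h A; rewrite !le_min => /andP[h0 /and5P[hh1 hh2 hh3 hh4 hh5]].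
move=> t0 thT rA Ad B.
have hQ1 : h * Q1 <= eta by rewrite -ler_pdivlMr.
have hC2 : h * C2 <= 4^-1.
  by move: hh5; rewrite -div1r ler_pdivlMr; [nra|lra].
have tT : 0 <= t <= T by rewrite t0; lra.
have thT' : 0 <= t + h <= T by rewrite thT andbT; lra.
set e := frob (A - X t) in Ad *; have e0 : 0 <= e by exact: frob_ge0.
have inT s : t < s < t + h -> 0 <= s <= T.
  by move=> /andP[ts sth]; apply/andP; split; lra.
have near_t s : t < s < t + h -> `|s - t| <= h.
  by move=> /andP[ts sth]; rewrite ger0_norm; lra.
pose G := Lbar t A h.
have GL : frob (G - L t A) <= eta.
  apply: unifLbar => //; last by rewrite hh1 ltW.
  have := frobD (A - X t) (X t); rewrite subrK -/e; have := Xq t tT; lra.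
have LL : frob (L t A - L t (X t)) <= K * e by exact: lipK.
have GQ1 : frob G <= Q1.
  have g1 := frobD (G - L t A) (L t A); rewrite subrK in g1.
  have g2 := frobD (L t A - L t (X t)) (L t (X t)); rewrite subrK in g2.
  have : K * e <= K * d by rewrite ler_wpM2l //; lra.
  by have := LQ t tT; rewrite /Q1; lra.
have hG s : t < s < t + h -> (s - t) * frob G <= eta.
  move=> /andP[ts sth]; apply: le_trans hQ1; have := frob_ge0 G => ?.
  by apply: ler_pM => //; lra.
have XX s : t < s < t + h -> frob (X t - X s) <= eta.
  move=> ts; rewrite frobBC.
  exact: unifX (inT s ts) (le_trans (near_t s ts) hh2).
have AX s : t < s < t + h -> frob (A - X s) <= e + eta.
  move=> ts; have := XX s ts.
  by have := frob_dist_triangle (X t) A (X s); rewrite -/e; lra.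
have AGX s : t < s < t + h -> frob (A + (s - t) *: G - X s) <= e + 2 * eta.
  move=> ts; have /andP[ts1 _] := ts; rewrite addrAC.
  apply: le_trans (frobD _ _) _; rewrite frobZ ger0_norm; last lra.
  by have := AX s ts; have := hG s ts; lra.
pose Y := A + h *: G.
have hG' : h * frob G <= eta by apply: le_trans hQ1; rewrite ler_wpM2l // ltW.
have YA : frob (Y - A) <= h * frob G.
  by rewrite /Y addrC addKr frobZ ger0_norm // ltW.
have Yd : frob (Y - X t) <= d.
  by have := frob_dist_triangle A Y (X t); rewrite -/e; lra.
have [_ rB NB YB] := tube t tT Y Yd.
split=> //; rewrite -/B in rB NB YB *.
(* The tube, used at its own centre, provides a bounded generalized inverse of X (t + h). *)
have XX0 : frob (X (t + h) - X (t + h)) <= d by rewrite subrr frob0 ltW.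
have [XWX _ _ _] := tube _ thT' _ XX0.
have [W Wg {}XWX] := XWX (rankX thT').
(* A itself has rank r, hence competes with the truncation, at distance O(h) from Y. *)
have Y_B : frob (Y - B) <= c * (h * Q1).
  apply: le_trans (YB A rA) _; rewrite ler_wpM2l //; apply: le_trans YA _.
  by rewrite ler_wpM2l // ltW.
have k_le : frob (Y - B) * frob W <= h * C2.
  rewrite (_ : h * C2 = c * (h * Q1) * g); last by rewrite /C2; ring.
  by apply: ler_pM; rewrite ?frob_ge0.
have Bstep := proj_step NB XWX (lexx (frob (Y - B) * frob W)).
apply: (@error_growth K Q g C2 e eta h (frob (Y - B) * frob W) _
    (frob (Y - X (t + h))));
  rewrite ?(ltW Q0) ?(ltW g0) ?(ltW h0) ?(ltW eta0) ?frob_ge0 //.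
- by rewrite mulr_ge0 ?frob_ge0.
- exact: le_trans k_le hC2.
pose dX' s := orth_proj (tangent r (X s)) (L s (X s)).
apply: (drift_bound (dX := dX')) => //.
- apply: continuous_subspaceW contX => s /=; rewrite !in_itv /=.
  move=> /andP[ts sth]; by apply/andP; split; lra.
- by move=> s /andP[ts sth]; apply: dX; apply/andP; split; lra.
move=> s ts; have sT := inT s ts; rewrite /dX'.
have rXs : \rank (X s) = r := rankX sT.
have := orth_proj_tangent (X s) (L s (X s)); rewrite rXs => -[N NX [-> NQ]].
have [|AW _ _ _] := tube s sT A; first by have := AX s ts; lra.
have [V Vg AVA] := AW rA; have /andP[ts1 _] := ts.
have NQ' := le_trans NQ (LQ s sT).
apply: drift_dot_le NX AVA NQ' Vg _ (hG s ts) _ _ (AGX s ts).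
- lra.
- have LLs : frob (L t (X t) - L s (X s)) <= eta.
    by rewrite frobBC; apply: unifL (inT s ts) (le_trans (near_t s ts) hh3).
  have := frob_dist_triangle (L t A) G (L s (X s)).
  by have := frob_dist_triangle (L t (X t)) (L t A) (L s (X s)); lra.
- by have := AX s ts; lra.
Qed.

Lemma scheme_error (A0 : 'M[R]_(l, m)) : 0 <= T -> X 0 = trunc_svd r A0 ->
  forall e, 0 < e -> exists2 h0, 0 < h0 & forall h, 0 < h <= h0 ->
  forall n, n%:R * h <= T -> frob (scheme r Lbar A0 h n - X (n%:R * h)) <= e.
Proof.
move=> T0 X0 e e0; have [d [Lam [d0 Lam0 step]]] := scheme_step.
pose M := expR (Lam * T); have M0 : 0 < M by exact: expR_gt0.
(* With rho <= d / 2 and eta <= d / 4, an error at most rho meets the tube condition of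
   [scheme_step]; eta M <= rho^2, with M bounding (1 + h Lam)^n, keeps the next error below rho. *)
pose rho := Num.min (d / 2) e.
have rho0 : 0 < rho by rewrite lt_min e0 divr_gt0.
pose eta := Num.min 1 (Num.min (d / 4) (rho ^+ 2 / M)).
have eta0 : 0 < eta by rewrite !lt_min ltr01 !divr_gt0 ?exprn_gt0.
have : eta <= eta by []; rewrite {2}/eta !le_min => /and3P[eta1 etad etaM].
have [|h0 h00 step_eta] := step eta; first by rewrite eta0.
exists h0 => // h hh0; have /andP[hgt _] := hh0.
suff main : forall n, n%:R * h <= T -> \rank (scheme r Lbar A0 h n) = r /\
    frob (scheme r Lbar A0 h n - X (n%:R * h)) ^+ 2 + eta <=
    (1 + h * Lam) ^+ n * eta /\
    frob (scheme r Lbar A0 h n - X (n%:R * h)) <= rho.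
  move=> n /main[_ [_]]; rewrite le_min => /andP[_].
  exact.
have small n E : n%:R * h <= T -> E ^+ 2 + eta <= (1 + h * Lam) ^+ n * eta ->
    0 <= E -> E <= rho.
  move=> nT En E0; rewrite -(@ler_pXn2r _ 2) ?nnegrE ?(ltW rho0) //.
  have : (1 + h * Lam) ^+ n <= M.
    apply: (@le_trans _ _ (expR (h * Lam) ^+ n)).
      have hL : 0 <= h * Lam by rewrite mulr_ge0 // ltW.
      by apply: lerXn2r; rewrite ?nnegrE ?expR_ge0 ?expR_ge1Dx //; lra.
    by rewrite -expRM_natl ler_expR mulrA mulrC ler_wpM2l.
  move: etaM; rewrite ler_pdivlMr // => etaM /(ler_wpM2r (ltW eta0)); lra.
elim=> [|n IH] nT.
  have err0 : frob (scheme r Lbar A0 h 0 - X (0%:R * h)) = 0.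
    by rewrite mul0r X0 subrr frob0.
  rewrite err0 expr0n /= add0r expr0 mul1r.
  split; last by split=> //; exact: ltW.
  by rewrite -X0; apply: rankX; rewrite lexx.
have nE : n.+1%:R * h = n%:R * h + h by rewrite -natr1 mulrDl mul1r.
have nT' : n%:R * h <= T by move: nT; rewrite nE; lra.
have [rn [En rhon]] := IH nT'.
have n0 : 0 <= n%:R * h by rewrite mulr_ge0 // ltW.
have nhT : n%:R * h + h <= T by rewrite -nE.
have [|rB EB] := step_eta _ _ _ hh0 n0 nhT rn.
  by move: rhon; rewrite le_min => /andP[]; lra.
have EB' : frob (scheme r Lbar A0 h n.+1 - X (n.+1%:R * h)) ^+ 2 + eta <=
    (1 + h * Lam) ^+ n.+1 * eta.
  rewrite nE [(1 + h * Lam) ^+ _]exprS -mulrA; apply: le_trans EB _.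
  rewrite ler_wpM2l //; by have := mulr_ge0 (ltW hgt) Lam0; lra.
by split=> //; split=> //; apply: (small n.+1) => //; exact: frob_ge0.
Qed.

End Convergence.

Theorem theorem5p4 (R : realType) (l m r : nat) (T : R) (hT : 0 < T)
    (L : R -> 'M[R]_(l, m) -> 'M[R]_(l, m))
    (Lbar : R -> 'M[R]_(l, m) -> R -> 'M[R]_(l, m))
    (fullR doR : R -> 'M[R]_(l, m))
    (hfull : solves_on T L fullR)
    (hgap : svd_gap r (fullR 0))
    (hcons : consistent T L Lbar)
    (hdoM : forall t : R, 0 <= t <= T -> fixed_rank r (doR t))
    (hdo0 : doR 0 = trunc_svd r (fullR 0))
    (hdo : solves_on T (fun t A => orth_proj (tangent r A) (L t A)) doR)
    (hlip : exists K : R, lipschitz_frob T K L) :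
  \big[Num.max/0]_(n < N.+1)
     frob (scheme r Lbar (fullR 0) (T / N%:R) n - doR (n%:R * (T / N%:R)))
    @[N --> \oo] --> (0 : R).
Proof.
have [U [s [V [svd0 gap]]]] := hgap.
have r0 : (0 < r)%N by case: (r) gap => //; rewrite ltxx.
apply/cvgrPdist_le => e e0.
have [h0 h00 err] := scheme_error r0 hcons hdoM hdo hlip (ltW hT) hdo0 e0.
near=> N.
have N0 : 0 < N%:R :> R by rewrite ltr0n; near: N; exact: nbhs_infty_gt.
have hN : 0 < T / N%:R <= h0.
  rewrite divr_gt0 //= ler_pdivrMr // mulrC -ler_pdivrMr //.
  by near: N; exact: nbhs_infty_ger.
rewrite sub0r normrN ger0_norm; last first.
  by apply/bigmax_geP; left.
apply: bigmax_le => [|n _]; first exact: ltW.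
apply: err => //; rewrite mulrCA ler_piMr ?(ltW hT) //.
by rewrite ler_pdivrMr // mul1r ler_nat -ltnS.
Unshelve. all: by end_near. Qed.
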